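(* Let $T:\mathbb{C}[x_1,\dots,x_d]\to\mathbb{C}$ be a pseudo-positive definite functional. Let $\sigma_{k,l}$, $k\in\mathbb{N}_0$, $l=1,\dots,a_k$, be non-negative measures with support in $[0,\infty)$ representing $T$ in the sense that $$T(f)=\sum_{k=0}^{\deg f}\sum_{l=1}^{a_k}\int_0^\infty f_{k,l}(r)\,r^{-k}\,d\sigma_{k,l}(r)\qquad\text{for all } f\in\mathbb{C}[x_1,\dots,x_d],$$ where $f_{k,l}$ are the Laplace–Fourier coefficients of $f$. If for every $N\in\mathbb{N}_0$ $$\sum_{k=0}^{\infty}\sum_{l=1}^{a_k}\int_0^\infty r^N r^{-k}\,d\sigma_{k,l}(r)<\infty,$$ then there exists a pseudo-positive, signed moment measure $\sigma$ on $\mathbb{R}^d$ such that $T(f)=\int f\,d\sigma$ for all $f\in\mathbb{C}[x_1,\dots,x_d]$.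
   Context: Fix an integer $d\ge 2$. $|x|$ is the Euclidean norm and $\mathbb{S}^{d-1}$ the unit sphere of $\mathbb{R}^d$ with surface measure $d\theta$. For each $k\in\mathbb{N}_0=\{0,1,2,\dots\}$, $Y_{k,1},\dots,Y_{k,a_k}:\mathbb{R}^d\to\mathbb{R}$ is a fixed basis of the space of harmonic homogeneous polynomials of degree $k$, orthonormal with respect to $\langle f,g\rangle=\int_{\mathbb{S}^{d-1}}f(\theta)\overline{g(\theta)}\,d\theta$. The Laplace–Fourier coefficients of a continuous function $f$ are $f_{k,l}(r)=\int_{\mathbb{S}^{d-1}}f(r\theta)Y_{k,l}(\theta)\,d\theta$. For a polynomial $f$, $f_{k,l}(r)r^{-k}$ is a polynomial in $r^2$ (this defines its value at $r=0$). By convention $r^{-k}=+\infty$ at $r=0$ for $k\ge1$. A linear functional $T:\mathbb{C}[x_1,\dots,x_d]\to\mathbb{C}$ is pseudo-positive definite if for all $k\in\mathbb{N}_0$, $l=1,\dots,a_k$ the component functional $T_{k,l}(p):=T(p(|x|^2)Y_{k,l}(x))$, $p\in\mathbb{C}[t]$, satisfies $T_{k,l}(p^*(t)p(t))\ge0$ and $T_{k,l}(t\,p^*(t)p(t))\ge0$ for all $p\in\mathbb{C}[t]$, where $p^*$ has the complex conjugate coefficients of $p$. A signed measure on $\mathbb{R}^d$ is a real-valued $\sigma$-additive set function on the Borel sets; it is a moment measure if all polynomials are integrable with respect to its total variation. A signed measure $\mu$ is pseudo-positive if $\int_{\mathbb{R}^d}h(|x|)Y_{k,l}(x)\,d\mu(x)\ge0$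 for every continuous compactly supported $h:[0,\infty)\to[0,\infty)$ and all $k,l$. *)

(* Defs.v *)
From HB Require Import structures.
From mathcomp Require Import all_boot all_order all_algebra.
From mathcomp Require Import complex.
(* The notations of mpoly clash with those of MathComp-Analysis. *)
From mathcomp Require Import -(notations) mpoly.
From mathcomp Require Import all_classical all_reals all_analysis.
From mathcomp Require Import measurable_realfun.

Set Implicit Arguments.
Unset Strict Implicit.
Unset Printing Implicit Defensive.

Import Order.TTheory GRing.Theory Num.Theory.
Import numFieldNormedType.Exports.

Local Open Scope classical_set_scope.
Local Open Scope ring_scope.

Notation "{ 'mpoly' T [ n ] }" := (mpoly n T)
  (at level 0, T, n at level 2, format "{ 'mpoly'  T [ n ] }") : type_scope.

Section euclidean_space.
Context {R : realType}.

Definition enorm d (x : d.-tuple R) : R :=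
  Num.sqrt (\sum_(i < d) tnth x i ^+ 2).

Definition scale_tuple d (r : R) (x : d.-tuple R) : d.-tuple R :=
  [tuple r * tnth x i | i < d].

(* x / |x|, and 0 at the origin since 0^-1 = 0 *)
Definition direction d (x : d.-tuple R) : d.-tuple R :=
  scale_tuple (enorm x)^-1 x.

Definition cons_pair n (p : measurableTypeR R * n.-tuple R) : n.+1.-tuple R :=
  [tuple of p.1 :: p.2].

(* Lebesgue measure on the product (= Borel) sigma-algebra of n.-tuple R *)
Fixpoint lebesgue_tuple n : set (n.-tuple R) -> \bar R :=
  match n with
  | 0%N => dirac [tuple]
  | m.+1 => pushforward (lebesgue_measure \x lebesgue_tuple (n := m))%E
                        (@cons_pair m)
  end.
Arguments lebesgue_tuple : clear implicits.

Let measurable_cons_pair n : measurable_fun setT (@cons_pair n).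
Proof.
apply: measurable_cons; last exact: measurable_snd.
apply: (@measurableT_comp _ _ _ _ _ _ (idfun : measurableTypeR R -> R)).
- by move=> _ A mA; rewrite setTI.
- exact: measurable_fst.
Qed.

Let lebesgue_tupleP n :
  exists m : {sigma_finite_measure set (n.-tuple R) -> \bar R},
    lebesgue_tuple n = m.
Proof.
elim: n => [|n [m IH]] /=; first by exists (dirac [tuple]).
pose leb := @lebesgue_measure R : {sigma_finite_measure set _ -> \bar R}.
pose nu := (leb \x m)%E : {measure set _ -> \bar R}.
pose mu := measure_function_pushforward__canonical__measure_function_Measure nu
  (@measurable_cons_pair n).
pose unc (t : n.+1.-tuple R) : measurableTypeR R * n.-tuple R :=
  (thead t, [tuple of behead t]).
have uncK : cancel (@cons_pair n) unc.
  by case=> x t; congr pair; apply: val_inj.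
have munc : measurable_fun setT unc.
  apply: measurable_fun_pair; last exact: measurable_behead.
  apply: (@measurableT_comp _ _ _ _ _ _ (idfun : R -> measurableTypeR R)).
    by move=> _ A mA; rewrite setTI.
  exact: measurable_tnth.
have sf : sigma_finite setT mu.
  have /sigma_finiteP[F [TF ndF Foo]] := sigma_finiteT leb.
  have /sigma_finiteP[G [TG ndG Goo]] := sigma_finiteT m.
  exists (fun i => unc @^-1` (F i `*` G i)).
    apply/seteqP; split => // t _.
    have [i _ Fi] : (\bigcup_i F i) (unc t).1 by rewrite -TF.
    have [j _ Gj] : (\bigcup_i G i) (unc t).2 by rewrite -TG.
    exists (maxn i j) => //; split.
    - by move: Fi; exact/subsetPset/ndF/leq_maxl.
    - by move: Gj; exact/subsetPset/ndG/leq_maxr.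
  move=> i; have [mF Fi] := Foo i; have [mG Gi] := Goo i; split.
    by rewrite -[X in measurable X]setTI; apply: munc => //; exact: measurableX.
  rewrite /mu /= /pushforward.
  rewrite (_ : _ @^-1` _ = F i `*` G i); last first.
    apply/funext => p.
    change ((F i `*` G i) (unc (cons_pair p)) = (F i `*` G i) p).
    by rewrite uncK.
  rewrite /nu /= product_measure1E//.
  by rewrite lte_mul_pinfty// ge0_fin_numE.
pose b := Measure_isSigmaFinite.Build _ _ _ mu sf.
pose s : {sigma_finite_measure set (n.+1.-tuple R) -> \bar R} :=
  HB.pack (Measure.sort mu) (Measure.class mu) b.
by exists s; rewrite IH.
Qed.

Let lebesgue_tuple0 n : lebesgue_tuple n set0 = 0%E.
Proof. by have [m ->] := lebesgue_tupleP n; exact: measure0. Qed.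

Let lebesgue_tuple_ge0 n A : (0 <= lebesgue_tuple n A)%E.
Proof. by have [m ->] := lebesgue_tupleP n; exact: measure_ge0. Qed.

Let lebesgue_tuple_sigma_additive n : semi_sigma_additive (lebesgue_tuple n).
Proof.
by have [m ->] := lebesgue_tupleP n; exact: measure_semi_sigma_additive.
Qed.

HB.instance Definition _ n := isMeasure.Build _ _ _ (lebesgue_tuple n)
  (@lebesgue_tuple0 n) (@lebesgue_tuple_ge0 n)
  (@lebesgue_tuple_sigma_additive n).

Let lebesgue_tuple_sigma_finite n : sigma_finite setT (lebesgue_tuple n).
Proof. by have [m ->] := lebesgue_tupleP n; exact: sigma_finiteT. Qed.

HB.instance Definition _ n := Measure_isSigmaFinite.Build _ _ _
  (lebesgue_tuple n) (@lebesgue_tuple_sigma_finite n).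

Lemma measurable_enorm d : measurable_fun setT (@enorm d).
Proof.
apply: (@measurableT_comp _ _ _ _ _ _ (@Num.sqrt R)).
  exact: (continuous_measurable_fun (@sqrt_continuous R)).
apply: measurable_sum => i.
by apply: measurable_funX; exact: measurable_tnth.
Qed.

Lemma measurable_direction d : measurable_fun setT (@direction d).
Proof.
apply/measurable_fun_tnthP => i.
rewrite (_ : _ \o _ = fun x : d.-tuple R => enorm x `^ (-1) * tnth x i).
  apply: measurable_funM; last exact: measurable_tnth.
  apply: (@measurableT_comp _ _ _ _ _ _ (@powR R ^~ (-1))).
    exact: measurable_powR.
  exact: measurable_enorm.
by apply/funext => x /=; rewrite tnth_mktuple powR_inv1// sqrtr_ge0.
Qed.

Definition unit_ball d : set (d.-tuple R) := [set x | enorm x <= 1].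

Lemma measurable_unit_ball d : measurable (@unit_ball d).
Proof.
rewrite -[X in measurable X]setTI /unit_ball.
rewrite (_ : [set x | _] = @enorm d @^-1` `]-oo, 1]); last first.
  by apply/seteqP; split => x /=; rewrite in_itv.
exact: measurable_enorm.
Qed.

(* Surface measure of the unit sphere, as a measure on the whole space carried
   by the sphere; it is defined through polar coordinates as d times the
   volume of the cone { x | |x| <= 1 and x / |x| \in A } (whose apex, the
   origin, is negligible). *)
Definition sphere_measure d (A : set (d.-tuple R)) : \bar R :=
  (d%:R%:E * lebesgue_tuple d (@direction d @^-1` A `&` @unit_ball d))%E.
Arguments sphere_measure d : clear implicits.

Let sphere_measureP d :
  exists m : {measure set (d.-tuple R) -> \bar R}, sphere_measure d = m.
Proof.
pose mu := measure_function_pushforward__canonical__measure_function_Measure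
  (mrestr (lebesgue_tuple d) (@measurable_unit_ball d))
  (@measurable_direction d).
by exists (mscale (d%:R)%:nng mu).
Qed.

Let sphere_measure0 d : sphere_measure d set0 = 0%E.
Proof. by have [m ->] := sphere_measureP d; exact: measure0. Qed.

Let sphere_measure_ge0 d A : (0 <= sphere_measure d A)%E.
Proof. by have [m ->] := sphere_measureP d; exact: measure_ge0. Qed.

Let sphere_measure_sigma_additive d : semi_sigma_additive (sphere_measure d).
Proof.
by have [m ->] := sphere_measureP d; exact: measure_semi_sigma_additive.
Qed.

HB.instance Definition _ d := isMeasure.Build _ _ _ (sphere_measure d)
  (@sphere_measure0 d) (@sphere_measure_ge0 d)
  (@sphere_measure_sigma_additive d).

End euclidean_space.
Arguments lebesgue_tuple {R} n A.
Arguments sphere_measure {R} d A.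

Section complex_integral.
Context {R : realType} {disp : measure_display} {T : measurableType disp}.
Implicit Types (mu : {measure set T -> \bar R}) (D : set T) (f : T -> R[i]).

Definition cintegrable mu D f :=
  mu.-integrable D (EFin \o (@complex.Re R \o f)) /\
  mu.-integrable D (EFin \o (@complex.Im R \o f)).

Definition cintegral mu D f : R[i] :=
  (Rintegral mu D (@complex.Re R \o f) +i* Rintegral mu D (@complex.Im R \o f))%C.

End complex_integral.

Section signed_integral.
Context {R : realType} {disp : measure_display} {T : measurableType disp}.
Variable nu : {charge set T -> \bar R}.

Lemma hahn_pair :
  {PN : set T * set T | hahn_decomposition nu PN.1 PN.2}.
Proof.
apply: cid; have [P [N PN]] := Hahn_decomposition nu.
by exists (P, N).
Qed.

(* The Jordan decomposition does not depend on the chosen Hahn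
   decomposition. *)
Definition positive_part : {measure set T -> \bar R} := jordan_pos (svalP hahn_pair).

Definition negative_part : {measure set T -> \bar R} := jordan_neg (svalP hahn_pair).

Definition total_variation : {measure set T -> \bar R} :=
  charge_variation (svalP hahn_pair).

Definition charge_integral (f : T -> R) : R :=
  Rintegral positive_part setT f - Rintegral negative_part setT f.

Definition charge_cintegral (f : T -> R[i]) : R[i] :=
  cintegral positive_part setT f - cintegral negative_part setT f.

End signed_integral.

Section harmonic_polynomials.
Context {R : realType} {d : nat}.
Local Open Scope complex_scope.

Definition peval (p : {mpoly R[d]}) (x : d.-tuple R) : R := meval (tnth x) p.

Definition cpeval (f : {mpoly (R[i])[d]}) (x : d.-tuple R) : R[i] :=
  meval (fun i => (tnth x i)%:C) f.

Definition complexify (p : {mpoly R[d]}) : {mpoly (R[i])[d]} :=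
  map_mpoly (real_complex R) p.

Definition mdegree (f : {mpoly (R[i])[d]}) : nat := (mmeasure mdeg f).-1.

(* the polynomial |x|^2 *)
Definition sqnorm : {mpoly (R[i])[d]} := \sum_(i < d) mpolyX _ (mnm1 i) ^+ 2.

Definition laplacian (p : {mpoly R[d]}) : {mpoly R[d]} :=
  \sum_(i < d) mderiv i (mderiv i p).

Definition harmonic_homogeneous (k : nat) : set {mpoly R[d]} :=
  [set p | p \is ishomog1 k mdeg /\ laplacian p = 0].

Definition orthonormal_harmonic_basis (k n : nat) (Y : 'I_n -> {mpoly R[d]}) :=
  [/\ forall l, harmonic_homogeneous k (Y l),
      forall p, harmonic_homogeneous k p ->
        exists! c : 'rV[R]_n, p = \sum_(l < n) c 0 l *: Y l &
      forall l m, Rintegral (sphere_measure d) setT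
        (fun x => peval (Y l) x * peval (Y m) x) = (l == m)%:R].

(* f_{k,l}(r), where Y stands for Y_{k,l} *)
Definition laplace_fourier (Y : {mpoly R[d]}) (f : {mpoly (R[i])[d]}) (r : R)
    : R[i] :=
  cintegral (sphere_measure d) setT
    (fun x => cpeval f (scale_tuple r x) * (peval Y x)%:C).

(* f_{k,l}(r) r^{-k}; for r > 0 this is q(r^2) for some polynomial q, and
   its value at r = 0 is q(0). *)
Definition laplace_fourier_quotient (k : nat) (Y : {mpoly R[d]})
    (f : {mpoly (R[i])[d]}) (r : R) : R[i] :=
  if r == 0 then
    (xget 0 [set q : {poly R[i]} | forall s : R, 0 < s ->
       laplace_fourier Y f s * (s%:C) ^- k = q.[(s ^+ 2)%:C]]).[0]
  else laplace_fourier Y f r * (r%:C) ^- k.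

End harmonic_polynomials.

Section pseudo_positivity.
Context {R : realType} {d : nat} (a : nat -> nat).
Variable Y : forall k, 'I_(a k) -> {mpoly R[d]}.
Local Open Scope complex_scope.

Definition component (T : {scalar {mpoly (R[i])[d]}}) k (l : 'I_(a k))
    (p : {poly R[i]}) : R[i] :=
  T (horner_alg sqnorm p * complexify (Y l)).

(* On R[i], 0 <= z means that z is real and nonnegative. *)
Definition pseudo_positive_definite (T : {scalar {mpoly (R[i])[d]}}) :=
  forall k (l : 'I_(a k)) (p : {poly R[i]}),
    0 <= component T l (map_poly conjc p * p) /\
    0 <= component T l ('X * (map_poly conjc p * p)).

Definition represents
    (sigma : forall k, 'I_(a k) -> {measure set R -> \bar R})
    (T : {scalar {mpoly (R[i])[d]}}) :=
  forall f : {mpoly (R[i])[d]},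
    (forall k (l : 'I_(a k)), (k <= mdegree f)%N ->
       cintegrable (sigma k l) `[0, +oo[ (laplace_fourier_quotient k (Y l) f)) /\
    T f = \sum_(0 <= k < (mdegree f).+1) \sum_(l < a k)
      cintegral (sigma k l) `[0, +oo[ (laplace_fourier_quotient k (Y l) f).

Definition pseudo_positive (nu : {charge set (d.-tuple R) -> \bar R}) :=
  forall h : R -> R,
    {within `[0, +oo[, continuous h} ->
    (forall r, 0 <= r -> 0 <= h r) ->
    compact (closure [set r | 0 <= r /\ h r != 0]) ->
    forall k (l : 'I_(a k)),
      0 <= charge_integral nu (fun x => h (enorm x) * peval (Y l) x).

End pseudo_positivity.

Definition moment_charge (R : realType) (d : nat)
    (nu : {charge set (d.-tuple R) -> \bar R}) :=
  forall f : {mpoly (R[i])[d]}, cintegrable (total_variation nu) setT (cpeval f).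

(* r^{-k}, with the convention 0^{-k} = +oo for k >= 1 *)
Definition inv_power (R : realType) (k : nat) (r : R) : \bar R :=
  if (r == 0) && (0 < k)%N then +oo%E else (r ^- k)%:E.

(* Main.v *)
(* Each sigma_{k,l} with density r^{-k} is a finite measure tau_{k,l} with all
   moments. The representing measure is the sum over k and l of the images
   under (r, theta) |-> r theta of Y_{k,l}(theta) dtau_{k,l}(r) dtheta. Since
   Y = ((1 + Y)/2)^2 - ((1 - Y)/2)^2 and the integral of Y^2 over the sphere is
   1, the sum is a difference of two positive measures, whose moments the
   summability hypothesis bounds. Integrating f against it gives the sum over
   all k of the integrals of f_{k,l}(r) r^{-k}, and these partial sums equal
   T f beyond the degree of f.

   Pseudo-positivity needs the orthogonality on the sphere of harmonic
   homogeneous polynomials of different degrees. It is first proved for the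
   weight e^{-|x|^2}, where one can integrate by parts coordinatewise, and
   transferred to the sphere by homogeneity, because the surface measure is the
   image of every radial density under x |-> x / |x|, up to a constant. *)
Require Import Defs.
From HB Require Import structures.
From mathcomp Require Import all_boot all_order all_algebra.
From mathcomp Require Import complex.
From mathcomp Require Import -(notations) mpoly.
From mathcomp Require Import all_classical all_reals all_analysis.
From mathcomp Require Import measurable_realfun.
From mathcomp Require Import ring lra zify.

Set Implicit Arguments.
Unset Strict Implicit.
Unset Printing Implicit Defensive.

Import Order.TTheory GRing.Theory Num.Theory.
Import numFieldNormedType.Exports.

Local Open Scope classical_set_scope.
Local Open Scope ring_scope.
Local Open Scope ereal_scope.

(** The Y_{k,l} are normalised in L^2 only, and their suprema may grow with k, so every bound has to
    go through integrals over the sphere. The squares serve this purpose: ((1 + Y)/2)^2 <= 1 + Y^2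
    has integral at most the area of the sphere plus 1, uniformly in k and l, and the densities stay
    polynomial. The formula for T f stops at the degree of f, whereas the measure produces all k.
    The classical way to discard k > deg f is to expand f into powers of |x|^2 times harmonic
    polynomials. Here the representation hypothesis itself is exploited: it is applied to a monomial
    of large degree and to f plus this monomial. The convention 0^{-k} = +oo forces sigma_{k,l} to
    have no mass at 0 for k >= 1, so the density r^{-k} causes no trouble there. The Gaussian weight
    is chosen because it is both radial and a product over the coordinates: the product form gives
    integration by parts without calculus on the sphere, the radial form gives the passage to the
    sphere. *)

Lemma exists_finite_measure d (T : measurableType d) (R : realType)
    (mu : {measure set T -> \bar R}) :
  mu setT < +oo -> exists m : {finite_measure set T -> \bar R}, m = mu :> (_ -> _).
Proof.
move=> muT.
have fin_mu : fin_num_fun mu.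
  move=> A mA; rewrite ge0_fin_numE//; apply: le_lt_trans muT.
  by apply: le_measure; rewrite ?inE.
case: mu fin_mu {muT} => mu0 mu0P fin_mu.
pose muF := Measure_isFinite.Build _ _ _ (Measure.Pack mu0P) fin_mu.
pose m : {finite_measure set T -> \bar R} := HB.pack mu0 mu0P muF.
by exists m.
Qed.

(** * Measures given by densities, and countable sums of measures *)

Section density.
Context d (T : measurableType d) (R : realType).
Variables (mu : {measure set T -> \bar R}) (D : set T) (f : T -> R).
Hypotheses (mD : measurable D) (mf : measurable_fun D f).
Hypotheses (f0 : forall x, D x -> (0 <= f x)%R).

Import HBNNSimple.

Let g : T -> \bar R := (EFin \o f) \_ D.

Let mg : measurable_fun setT g.
Proof. by apply/(measurable_restrictT _ mD)/measurable_EFinP. Qed.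

Let g0 x : 0 <= g x.
Proof. by apply: erestrict_ge0 => y Dy; rewrite lee_fin f0. Qed.

(** [mu] is arbitrary because the measures [sigma k l] of the theorem are; the change of variables
    therefore goes through simple functions and monotone convergence, not through Radon-Nikodym
    derivatives, which ask for sigma-finiteness. *)
Lemma exists_density : exists m : {measure set T -> \bar R},
  forall h : T -> \bar R, measurable_fun setT h -> (forall x, 0 <= h x) ->
    \int[m]_x h x = \int[mu]_(x in D) (h x * (f x)%:E).
Proof.
pose nu A := \int[mu]_(x in A) g x.
have nu0 : nu set0 = 0 by rewrite /nu integral_set0.
have nu_ge0 A : 0 <= nu A by exact: integral_ge0.
have nuS : semi_sigma_additive nu by exact: semi_sigma_additive_nng_induced.
pose nuM := isMeasure.Build _ _ _ nu nu0 nu_ge0 nuS.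
pose m : {measure set T -> \bar R} := HB.pack nu nuM.
exists m => h mh h0.
transitivity (\int[mu]_x (h x * g x)); last first.
  rewrite [RHS]integral_mkcond; apply: eq_integral => x _.
  by rewrite /g !patchE; case: ifPn => //; rewrite mule0.
pose a := nnsfun_approx measurableT mh.
have cvga x : EFin \o a ^~ x @ \oo --> h x by exact: cvg_nnsfun_approx.
have -> : \int[m]_x h x = limn (fun n => \int[m]_x (a n x)%:E).
  rewrite -monotone_convergence//.
  - by apply: eq_integral => x _; apply/esym/cvg_lim => //; exact: cvga.
  - by move=> n; exact/measurable_EFinP.
  - by move=> n x _; rewrite lee_fin.
  - by move=> x _ i j ij; rewrite lee_fin; exact/lefP/nd_nnsfun_approx.
have gfin x : g x \is a fin_num by rewrite /g patchE; case: ifPn.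
have -> : \int[mu]_x (h x * g x) = limn (fun n => \int[mu]_x ((a n x)%:E * g x)).
  rewrite -monotone_convergence//.
  - apply: eq_integral => x _; apply/esym/cvg_lim => //.
    by apply: cvgeZr => //; exact: cvga.
  - by move=> n; apply: emeasurable_funM => //; exact/measurable_EFinP.
  - by move=> n x _; rewrite mule_ge0 ?lee_fin.
  - move=> x _ i j ij; rewrite lee_wpmul2r ?lee_fin//.
    exact/lefP/nd_nnsfun_approx.
congr (limn _); apply/funext => n.
rewrite integralT_nnsfun sintegralE.
transitivity (\int[mu]_x (\sum_(y \in range (a n))
    (y * \1_(a n @^-1` [set y]) x)%:E * g x)); last first.
  apply: eq_integral => x _.
  rewrite -ge0_mule_fsuml => [|y]; last exact: nnfun_muleindic_ge0.
  by rewrite fsumEFin// -(fimfunE _ x).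
rewrite ge0_integral_fsum//; last 2 first.
  - move=> y; apply: emeasurable_funM => //; apply/measurable_EFinP.
    exact: measurable_funM.
  - by move=> y x _; rewrite mule_ge0// nnfun_muleindic_ge0.
apply: eq_fsbigr => r; rewrite inE => -[t _ <-].
under eq_integral do rewrite EFinM -muleA.
rewrite ge0_integralZl//.
- congr (_ * _); rewrite /= /nu integral_mkcond; apply: eq_integral => x _.
  by rewrite epatch_indic muleC.
- by apply: emeasurable_funM => //; exact/measurable_EFinP.
- by move=> x _; rewrite mule_ge0 ?lee_fin.
- by rewrite lee_fin.
Qed.

Lemma exists_finite_density : \int[mu]_(x in D) (f x)%:E < +oo ->
  exists m : {finite_measure set T -> \bar R},
  forall h : T -> \bar R, measurable_fun setT h -> (forall x, 0 <= h x) ->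
    \int[m]_x h x = \int[mu]_(x in D) (h x * (f x)%:E).
Proof.
move=> foo; have [m mE] := exists_density.
have mT : m setT < +oo.
  rewrite -[m setT]mul1e -integral_cst// mE//.
  by under eq_integral do rewrite mul1e.
by have [m' m'E] := exists_finite_measure mT; exists m' => h mh h0; rewrite m'E mE.
Qed.

End density.

(** Multiplication by f >= 0 commutes with positive and negative parts, so the formula for
    nonnegative functions applies to each part, whether or not g is integrable. *)
Lemma density_integral_EFin d (T : measurableType d) (R : realType)
    (m mu : {measure set T -> \bar R}) (D : set T) (f : T -> R) :
  (forall x, D x -> (0 <= f x)%R) ->
  (forall h : T -> \bar R, measurable_fun setT h -> (forall x, 0 <= h x) ->
    \int[m]_x h x = \int[mu]_(x in D) (h x * (f x)%:E)) ->
  forall g : T -> R, measurable_fun setT g ->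
    \int[m]_x (g x)%:E = \int[mu]_(x in D) (g x * f x)%:E.
Proof.
move=> f0 mE g mg; rewrite integralE [RHS]integralE.
have mg' : measurable_fun setT (EFin \o g) by exact/measurable_EFinP.
rewrite !mE//; [|exact: measurable_funeneg|exact: measurable_funepos].
congr (_ - _); apply: eq_integral => x; rewrite inE => Dx.
  by rewrite !funeposE [in RHS]mulrC EFinM muleC maxe_pMr ?mule0 ?lee_fin ?f0.
rewrite !funenegE -!EFinN -[in RHS]mulNr [in RHS]mulrC EFinM muleC.
by rewrite maxe_pMr ?mule0 ?lee_fin ?f0.
Qed.

Lemma exists_measure_sum d (T : measurableType d) (R : realType)
    (a : nat -> nat) (m : forall k, 'I_(a k) -> {measure set T -> \bar R}) :
  exists M : {measure set T -> \bar R},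
  forall h : T -> \bar R, measurable_fun setT h -> (forall x, 0 <= h x) ->
    \int[M]_x h x = \sum_(0 <= k <oo) \sum_(l < a k) \int[m k l]_x h x.
Proof.
(* [msum] takes a family indexed by [nat]; the value [mzero] is a filler for j >= a k and is never
   summed. *)
pose m' k (j : nat) : {measure set T -> \bar R} :=
  if insub j is Some l then m k l else mzero.
pose M_ k : {measure set T -> \bar R} := msum (m' k) (a k).
exists (mseries M_ 0) => h mh h0.
rewrite ge0_integral_measure_series//; apply: eq_eseriesr => k _.
rewrite ge0_integral_measure_sum//; apply: eq_bigr => l _.
by rewrite /m' valK.
Qed.

(** * Integrals against a difference of two finite measures *)

Section charge_integral.
Context d (T : measurableType d) (R : realType).
Variables (nu : {charge set T -> \bar R}) (M1 M2 : {finite_measure set T -> \bar R}).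
Hypothesis nuE : forall A, measurable A -> nu A = M1 A - M2 A.

Let pos := positive_part nu.
Let neg := negative_part nu.

Let posE A : measurable A -> pos A = nu (A `&` (sval (hahn_pair nu)).1).
Proof.
move=> mA; have -> : pos A = jordan_pos (svalP (hahn_pair nu)) A by [].
by rewrite jordan_posE cjordan_posE /crestr0 mem_set.
Qed.

Let negE A : measurable A -> neg A = - nu (A `&` (sval (hahn_pair nu)).2).
Proof.
move=> mA; have -> : neg A = jordan_neg (svalP (hahn_pair nu)) A by [].
by rewrite jordan_negE cjordan_negE /crestr0 mem_set.
Qed.

Let mP : measurable (sval (hahn_pair nu)).1.
Proof. by case: (svalP (hahn_pair nu)) => -[]. Qed.

Let mN : measurable (sval (hahn_pair nu)).2.
Proof. by case: (svalP (hahn_pair nu)) => _ []. Qed.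

Let fin (M : {finite_measure set T -> \bar R}) A : measurable A -> M A \is a fin_num.
Proof. exact: fin_num_measure. Qed.

(** Minimality of the Jordan decomposition: on the positive set of [nu] the term in [M2] only lowers
    the value. This transfers integrability from [M1] to the positive part. *)
Let pos_le A : measurable A -> pos A <= M1 A.
Proof.
move=> mA; rewrite posE// nuE//; last exact: measurableI.
apply: (@le_trans _ _ (M1 (A `&` (sval (hahn_pair nu)).1))).
  by rewrite leeBlDr ?fin//; [rewrite leeDl|exact: measurableI].
by apply: le_measure; rewrite ?inE//; exact: measurableI.
Qed.

Let neg_le A : measurable A -> neg A <= M2 A.
Proof.
have mAN : measurable A -> measurable (A `&` (sval (hahn_pair nu)).2).
  by move=> mA; exact: measurableI.
move=> mA; rewrite negE// nuE//; last exact: measurableI.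
apply: (@le_trans _ _ (M2 (A `&` (sval (hahn_pair nu)).2))).
  rewrite fin_num_oppeB ?fin//; last exact: mAN.
  by rewrite addeC leeBlDr ?fin ?leeDl//; exact: mAN.
by apply: le_measure; rewrite ?inE//; exact: measurableI.
Qed.

(** With sums instead of differences on both sides this is an equality of measures, which can be
    integrated directly. *)
Let pos_neg A : measurable A -> measure_add pos M2 A = measure_add neg M1 A.
Proof.
move=> mA.
have := jordan_decomp (svalP (hahn_pair nu)) mA.
rewrite nuE// /cadd/= cscaleN1 => e.
have fp : pos A \is a fin_num.
  by rewrite ge0_fin_numE//; apply: le_lt_trans (pos_le mA) _; rewrite -ge0_fin_numE// fin.
have fn : neg A \is a fin_num.
  by rewrite ge0_fin_numE//; apply: le_lt_trans (neg_le mA) _; rewrite -ge0_fin_numE// fin.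
have {}e : M1 A - M2 A = pos A - neg A by exact: e.
have -> : measure_add pos M2 A = pos A + M2 A by rewrite measure_addE.
have -> : measure_add neg M1 A = neg A + M1 A by rewrite measure_addE.
move: fp fn e (fin M1 mA) (fin M2 mA).
case: (pos A) (neg A) (M1 A) (M2 A) => [p| |] [n| |] [x| |] [y| |]// _ _ [e] _ _.
by congr _%:E; lra.
Qed.

Variable g : T -> R.
Hypotheses (g1 : M1.-integrable setT (EFin \o g)) (g2 : M2.-integrable setT (EFin \o g)).

Let mg : measurable_fun setT (EFin \o g). Proof. exact: measurable_int g1. Qed.

Let integrable_le (m M : {measure set T -> \bar R}) :
  (forall A, measurable A -> m A <= M A) -> M.-integrable setT (EFin \o g) ->
  m.-integrable setT (EFin \o g).
Proof.
move=> mM /integrableP[_ goo]; apply/integrableP; split => //.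
apply: le_lt_trans goo; apply: ge0_le_measure_integral => //.
exact: measurableT_comp.
Qed.

Lemma charge_integralE :
  charge_integral nu g = (\int[M1]_x g x - \int[M2]_x g x)%R.
Proof.
have gp : pos.-integrable setT (EFin \o g) by exact: integrable_le pos_le g1.
have gn : neg.-integrable setT (EFin \o g) by exact: integrable_le neg_le g2.
have : \int[measure_add pos M2]_x (g x)%:E = \int[measure_add neg M1]_x (g x)%:E.
  by apply: eq_measure_integral => A mA _; exact: pos_neg.
rewrite !integral_measure_add// /charge_integral /Rintegral -/pos -/neg.
move: (integrable_fin_num measurableT gp) (integrable_fin_num measurableT gn)
  (integrable_fin_num measurableT g1) (integrable_fin_num measurableT g2) => /=.
by do 4 case: integral => [?| |]//; move=> _ _ _ _ [] /=; lra.
Qed.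

Lemma integrable_total_variation :
  (Defs.total_variation nu).-integrable setT (EFin \o g).
Proof.
have gp : pos.-integrable setT (EFin \o g) by exact: integrable_le pos_le g1.
have gn : neg.-integrable setT (EFin \o g) by exact: integrable_le neg_le g2.
apply/integrableP; split => //.
rewrite (eq_measure_integral (measure_add pos neg)); last first.
  move=> A mA _.
  by symmetry; exact: measure_addE.
rewrite ge0_integral_measure_add//; last exact: measurableT_comp.
by apply: lte_add_pinfty; [case/integrableP: gp|case/integrableP: gn].
Qed.

End charge_integral.

Lemma exists_chargeB d (T : measurableType d) (R : realType)
    (M1 M2 : {finite_measure set T -> \bar R}) :
  exists nu : {charge set T -> \bar R}, forall A, measurable A -> nu A = M1 A - M2 A.
Proof.
exists (cadd (charge_of_finite_measure M1)
  (cscale (-1) (charge_of_finite_measure M2))) => A mA.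
by transitivity (M1 A + (-1)%:E * M2 A) => //; rewrite mulN1e.
Qed.

(** * Moments of the weight e^{-x^2} on the line *)

Section gauss_moments.
Local Open Scope ring_scope.
Context {R : realType}.
Notation mu := (@lebesgue_measure R).

(** The fundamental theorem of calculus on [-(n+1), n+1] combined with dominated convergence; limits
    of F along integers suffice because only these intervals occur. *)
Lemma integral_derivative_eq0 (F f : R -> R) :
  continuous f -> (forall x : R, is_derive x 1%R F (f x)) ->
  mu.-integrable setT (EFin \o f) ->
  F n.+1%:R @[n --> \oo] --> (0%R : R) ->
  F (- n.+1%:R)%R @[n --> \oo] --> (0%R : R) ->
  (\int[mu]_x f x = 0)%R.
Proof.
move=> cf dF fi Fp Fn.
pose I n := `[- n.+1%:R, n.+1%:R]%classic : set R.
have mf : measurable_fun setT (EFin \o f) by exact: measurable_int fi.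
have cF x : {for x, continuous F}.
  by apply/differentiable_continuous/derivable1_diffP; have [] := dF x.
pose f_ n := (EFin \o f) \_ (I n).
have : (\int[mu]_x f_ n x @[n --> \oo] --> \int[mu]_x (f x)%:E)%E.
  apply: (@dominated_cvg _ (measurableTypeR R) R mu setT measurableT f_
    (EFin \o f) (fun x => `|(f x)%:E|%E)) => //.
  - move=> n; have mI : measurable (I n) by exact: measurable_itv.
    by apply/(measurable_restrictT _ mI); exact: measurable_funS mf.
  - move=> x _; apply: cvg_near_cst; near=> n; rewrite /f_ patchE ifT// inE /I/=.
    have : (`|x| <= n.+1%:R)%R.
      apply: (@le_trans _ _ n%:R); last by rewrite ler_nat.
      by near: n; exact: nbhs_infty_ger.
    by rewrite ler_norml in_itv/=.
  - exact: integrable_abse.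
  - by move=> n x _; rewrite /f_ patchE; case: ifPn => // _; rewrite abse0.
have IE n : (\int[mu]_x f_ n x = (F n.+1%:R)%:E - (F (- n.+1%:R))%:E)%E.
  rewrite /f_ -integral_mkcond -(@continuous_FTC2 _ f)//.
  - by rewrite -subr_gt0 opprK -natrD ltr0n.
  - exact: continuous_subspaceT.
  - split => [x _||]; first by have [] := dF x.
    + exact/cvg_at_right_filter/cF.
    + exact/cvg_at_left_filter/cF.
  - by move=> x _; rewrite derive1E; exact: derive_val.
under eq_fun do rewrite IE.
have l0 : (F n.+1%:R - F (- n.+1%:R))%:E @[n --> \oo] --> (0 - 0)%:E.
  by apply: cvg_EFin; [exact: nearW|apply: cvgB].
rewrite /Rintegral => /(cvg_unique _ l0) <- //=; rewrite subr0.
Unshelve. all: by end_near. Qed.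

Lemma expR_bound_pow n : exists C : R, forall x : R,
  (`|x| ^+ n <= C * expR (x ^+ 2 / 2))%R.
Proof.
(* The 1 covers |x| <= 1. The other term comes from the summand (x^2/2)^(n+1) / (n+1)! of the
   exponential series, since |x|^n <= |x|^(2(n+1)) for |x| > 1. *)
exists (1 + 2 ^+ n.+1 * (n.+1)`!%:R)%R => x.
have e1 : (1 <= expR (x ^+ 2 / 2))%R.
  by rewrite -expR0 ler_expR divr_ge0// sqr_ge0.
have e2 : (`|x| ^+ (2 * n.+1) <= 2 ^+ n.+1 * (n.+1)`!%:R * expR (x ^+ 2 / 2))%R.
  have /(expR_ge1Dxn n) h : (0 <= x ^+ 2 / 2)%R by rewrite divr_ge0// sqr_ge0.
  rewrite exprM real_normK ?num_real//.
  rewrite -ler_pdivrMl ?mulr_gt0 ?exprn_gt0 ?ltr0n ?fact_gt0//.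
  by apply: le_trans h; rewrite mulrC invfM mulrA -expr_div_n lerDr.
rewrite mulrDl mul1r; case: (leP `|x| 1) => x1.
  apply: (le_trans (exprn_ile1 n (normr_ge0 _) x1)).
  apply: (le_trans e1); rewrite lerDl; apply: le_trans e2.
  by rewrite exprn_ge0.
apply: (@le_trans _ _ (`|x| ^+ (2 * n.+1))).
  by apply: ler_weXn2l; [exact: ltW|lia].
by apply: (le_trans e2); rewrite lerDr expR_ge0.
Qed.

Let gaussE (x : R) : gauss_fun x = (expR (- (x ^+ 2 / 2)) * expR (- (x ^+ 2 / 2)))%R.
Proof. by rewrite -expRD /gauss_fun; congr expR; field. Qed.

(** e^{-x^2} is split into two equal factors: one absorbs the power, the other is left for
    integrability, being the standard normal density up to a constant. *)
Lemma gauss_bound_pow n : exists C : R, forall x : R,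
  (`|x| ^+ n * gauss_fun x <= C * expR (- (x ^+ 2 / 2)))%R.
Proof.
have [C h] := expR_bound_pow n; exists C => x.
by rewrite gaussE mulrA ler_pM2r ?expR_gt0// expRN ler_pdivrMr ?expR_gt0.
Qed.

Lemma integrable_pow_gauss n :
  mu.-integrable setT (EFin \o (fun x : R => x ^+ n * gauss_fun x)%R).
Proof.
have [C h] := gauss_bound_pow n.
have := integrable_normal_pdf (0 : R) 1.
move=> /(integrableZl measurableT (C / normal_peak 1)).
apply: le_integrable => //.
  apply/measurable_EFinP/measurable_funM; last exact: measurable_gauss_fun.
  exact: exprn_measurable.
move=> x _; rewrite /= lee_fin normrM normrX (ger0_norm (gauss_fun_ge0 _)).
apply: (le_trans (h x)); apply: le_trans (ler_norm _).
rewrite /normal_pdf oner_eq0 /normal_fun /= mulrA divfK; last first.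
  by rewrite gt_eqF// normal_peak_gt0// oner_eq0.
by rewrite subr0 expr1n mulNr.
Qed.

Lemma cvg_pow_gauss n (u : R^nat) : (forall k, `|u k| = k.+1%:R)%R ->
  (u k ^+ n * gauss_fun (u k))%R @[k --> \oo] --> (0 : R).
Proof.
(* The bound is taken for the exponent n + 1, which leaves a factor 1 / |u k| = 1 / (k + 1). *)
move=> uk; have [C h] := gauss_bound_pow n.+1.
apply/norm_cvg0P.
apply: (@squeeze_cvgr _ _ _ _ (fun=> 0%R) (fun k => C * harmonic k)%R).
- apply: nearW => k; rewrite normr_ge0/= normrM normrX.
  rewrite (ger0_norm (gauss_fun_ge0 _)) ler_pdivlMr ?ltr0n// -uk mulrAC -exprSr.
  apply: (le_trans (h _)).
  have C0 : (0 <= C)%R.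
    have := h 0%R; rewrite normr0 expr0n/= mul0r expr0n/= mul0r oppr0 expR0.
    by rewrite mulr1.
  by rewrite ler_piMr// -expR0 ler_expR oppr_le0 divr_ge0// sqr_ge0.
- exact: cvg_cst.
- by rewrite -(mulr0 C); apply: cvgMr; exact: cvg_harmonic.
Qed.

Definition gauss_moment n : R := (\int[mu]_x (x ^+ n * gauss_fun x))%R.

(** The derivative of x^n e^{-x^2} has integral 0. For n = 0 the truncated [n.-1] is harmless, its
    factor being 0, and the identity says that the first moment vanishes. *)
Lemma gauss_moment_rec n :
  (n%:R * gauss_moment n.-1 = 2 * gauss_moment n.+1)%R.
Proof.
pose F (x : R) := (x ^+ n * gauss_fun x)%R.
pose f (x : R) := (n%:R * (x ^+ n.-1 * gauss_fun x) -
                   2 * (x ^+ n.+1 * gauss_fun x))%R.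
have i1 := integrable_pow_gauss n.-1; have i2 := integrable_pow_gauss n.+1.
have j1 : mu.-integrable setT
    (EFin \o (fun x => n%:R * (x ^+ n.-1 * gauss_fun x))%R).
  by apply: (integrableZl measurableT n%:R) i1.
have j2 : mu.-integrable setT
    (EFin \o (fun x => 2 * (x ^+ n.+1 * gauss_fun x))%R).
  by apply: (integrableZl measurableT 2%R) i2.
have : (\int[mu]_x f x = 0)%R.
  apply: (integral_derivative_eq0 (F := F)).
  - move=> x; apply: cvgB; apply: cvgM; try exact: cvg_cst.
      by apply: cvgM; [exact: exprn_continuous|exact: continuous_gauss_fun].
    by apply: cvgM; [exact: exprn_continuous|exact: continuous_gauss_fun].
  - move=> x.
    have hX k : is_derive x 1 (fun y : R => y ^+ k) ((k%:R * x ^+ k.-1) *: 1).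
      by have := is_deriveX k (is_derive_id x (1 : R)); rewrite exprfctE.
    have hg : is_derive x 1 gauss_fun (gauss_fun x * - ((2 * x ^+ 1) *: 1)).
      exact: (@is_derive1_comp _ expR (fun y => - y ^+ 2)).
    apply: is_derive_eq (is_deriveM (hX n) hg) _.
    have scE (u v : R) : u *: v = u * v by [].
    rewrite !scE /f expr1 (exprS x n).
    by move: (x ^+ n.-1) (x ^+ n) (gauss_fun x) => p q g; ring.
  - exact: (integrableB measurableT j1 j2).
  - by apply: (@cvg_pow_gauss n (fun k => k.+1%:R)%R) => k; rewrite ger0_norm.
  - by apply: (@cvg_pow_gauss n (fun k => - k.+1%:R)%R) => k; rewrite normrN ger0_norm.
rewrite RintegralB// RintegralZl// RintegralZl// => /eqP.
by rewrite subr_eq0 => /eqP.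
Qed.

End gauss_moments.

(** * Lebesgue measure on tuples: scaling and product functions *)

Section lebesgue_tuple_theory.
Context {R : realType}.
Notation mu := (@lebesgue_measure R).
Notation lebesgue_tuple := (@lebesgue_tuple R).

Lemma measurable_cons_pair n : measurable_fun setT (@cons_pair R n).
Proof.
apply: measurable_cons; last exact: measurable_snd.
apply: (@measurableT_comp _ _ _ _ _ _ (idfun : measurableTypeR R -> R)).
- by move=> _ A mA; rewrite setTI.
- exact: measurable_fst.
Qed.

Lemma measurable_scale_tuple n (r : R) : measurable_fun setT (@scale_tuple R n r).
Proof.
apply/measurable_fun_tnthP => i.
rewrite (_ : _ \o _ = fun x => (r * tnth x i)%R).
  by apply: measurable_funM => //; exact: measurable_tnth.
by apply/funext => x /=; rewrite tnth_mktuple.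
Qed.

Lemma scale_cons_pair n (r : R) (x : measurableTypeR R) (t : n.-tuple R) :
  scale_tuple r (cons_pair (x, t)) = cons_pair ((r * x)%R, scale_tuple r t).
Proof.
apply: eq_from_tnth => i; rewrite tnth_mktuple.
case: (unliftP ord0 i) => [j ->|->]; last by rewrite !tnth0.
by rewrite !tnthS tnth_mktuple.
Qed.

Let lebesgue_tuple_push n (F : n.+1.-tuple R -> \bar R) :
  \int[lebesgue_tuple n.+1]_x F x =
  \int[pushforward (mu \x lebesgue_tuple n) (@cons_pair R n)]_x F x.
Proof. by []. Qed.

Lemma ge0_integral_lebesgue_tupleS n (F : n.+1.-tuple R -> \bar R) :
  measurable_fun setT F -> (forall x, 0 <= F x) ->
  \int[lebesgue_tuple n.+1]_x F x =
  \int[mu]_x \int[lebesgue_tuple n]_t F (cons_pair (x, t)).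
Proof.
move=> mF F0; rewrite lebesgue_tuple_push.
rewrite (ge0_integral_pushforward (@measurable_cons_pair n))//.
rewrite preimage_setT (fubini_tonelli1 (F \o @cons_pair R n))//.
  exact: (measurableT_comp mF (@measurable_cons_pair n)).
by move=> z; exact: F0.
Qed.

(** Lebesgue measure is determined by its values on bounded intervals, where it agrees with r times
    its image under x |-> r x. *)
Lemma ge0_integral_lebesgue_scale (r : R) (F : measurableTypeR R -> \bar R) :
  (0 < r)%R -> measurable_fun setT F -> (forall x, 0 <= F x) ->
  \int[mu]_x F x = r%:E * \int[mu]_x F (r * x)%R.
Proof.
move=> r0 mF F0.
have mr : measurable_fun setT (fun x : measurableTypeR R => (r * x)%R : measurableTypeR R).
  exact: mulrl_measurable.
pose m := measure_function_pushforward__canonical__measure_function_Measure mu mr.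
pose rr : {nonneg R} := NngNum (ltW r0).
have mE A : measurable A -> mu A = mscale rr m A.
  apply: lebesgue_measure_unique => _ [[a b] ab <-] /=.
  rewrite /mscale/= /pushforward lebesgue_measure_itv/=.
  rewrite (_ : (fun x : R => r * x)%R @^-1` _ = `]a / r, b / r]%classic)%R; last first.
    apply/seteqP; split => x /=; rewrite !in_itv/=.
      by rewrite ltr_pdivrMr// ler_pdivlMr// ![(x * r)%R]mulrC.
    by rewrite ltr_pdivrMr// ler_pdivlMr// ![(x * r)%R]mulrC.
  rewrite lebesgue_measure_itv/= !lte_fin ltr_pM2r ?invr_gt0//.
  case: ifPn => _; last by rewrite mule0.
  by rewrite -!EFinB -EFinM; congr EFin; field; rewrite gt_eqF.
rewrite (eq_measure_integral (mscale rr m)); last by move=> A mA _; exact: mE.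
rewrite ge0_integral_mscale//; congr (_ * _).
by rewrite (ge0_integral_pushforward mr)// preimage_setT.
Qed.

Lemma ge0_integral_lebesgue_tuple_scale n (r : R) (F : n.-tuple R -> \bar R) :
  (0 < r)%R -> measurable_fun setT F -> (forall x, 0 <= F x) ->
  \int[lebesgue_tuple n]_x F x =
  (r ^+ n)%:E * \int[lebesgue_tuple n]_x F (scale_tuple r x).
Proof.
move=> r0; elim: n F => [|n IH] F mF F0.
  by rewrite expr0 mul1e; apply: eq_integral => x _; rewrite !(tuple0 x) (tuple0 (scale_tuple _ _)).
have mFc : measurable_fun setT (F \o @cons_pair R n).
  exact: (measurableT_comp mF (@measurable_cons_pair n)).
rewrite ge0_integral_lebesgue_tupleS// ge0_integral_lebesgue_tupleS//; last first.
  exact: (measurableT_comp mF (measurable_scale_tuple r)).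
pose G (x : measurableTypeR R) := \int[lebesgue_tuple n]_t F (cons_pair (x, scale_tuple r t)).
transitivity (\int[mu]_x ((r ^+ n)%:E * G x)).
  apply: eq_integral => x _; apply: IH => //.
  exact: (measurableT_comp mFc (pair1_measurable x)).
have mG : measurable_fun setT G.
  apply: (measurable_fun_fubini_tonelli_F (m2 := lebesgue_tuple n)
    (fun z => F (cons_pair (z.1, scale_tuple r z.2)))) => //.
  apply: (measurableT_comp mFc); apply: measurable_fun_pair => //.
  exact: (measurableT_comp (measurable_scale_tuple r) measurable_snd).
rewrite ge0_integralZl//; last 2 first.
- by move=> x _; exact: integral_ge0.
- by rewrite lee_fin exprn_ge0// ltW.
rewrite (ge0_integral_lebesgue_scale r0 mG); last by move=> x; exact: integral_ge0.
rewrite muleA -EFinM -exprSr; congr (_ * _); apply: eq_integral => x _.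
by apply: eq_integral => t _; rewrite scale_cons_pair.
Qed.

Lemma integrable_prod_sep n (f : measurableTypeR R -> R) (g : n.-tuple R -> R) :
  mu.-integrable setT (EFin \o f) ->
  (lebesgue_tuple n).-integrable setT (EFin \o g) ->
  (mu \x lebesgue_tuple n).-integrable setT (fun z => (f z.1 * g z.2)%:E).
Proof.
move=> fi gi.
have mf : measurable_fun setT f by apply/measurable_EFinP; exact: measurable_int fi.
have mg : measurable_fun setT g by apply/measurable_EFinP; exact: measurable_int gi.
apply/integrable12ltyP => /=.
  apply/measurable_EFinP/measurable_funM.
    exact: (measurableT_comp mf measurable_fst).
  exact: (measurableT_comp mg measurable_snd).
under eq_integral => x _.
  under eq_integral do rewrite normrM EFinM.
  rewrite ge0_integralZl//; last exact/measurable_EFinP/measurableT_comp.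
  over.
rewrite /= ge0_integralZr//; last 2 first.
- exact/measurable_EFinP/measurableT_comp.
- by apply: integral_ge0 => t _; rewrite lee_fin.
case/integrableP : fi => _ fi; case/integrableP : gi => _ gi.
by rewrite lte_mul_pinfty// ?integral_ge0// ge0_fin_numE ?integral_ge0.
Qed.

Lemma integral_prod_sep n (f : measurableTypeR R -> R) (g : n.-tuple R -> R) :
  mu.-integrable setT (EFin \o f) ->
  (lebesgue_tuple n).-integrable setT (EFin \o g) ->
  \int[mu \x lebesgue_tuple n]_z (f z.1 * g z.2)%:E =
  (\int[mu]_x (f x)%:E) * (\int[lebesgue_tuple n]_t (g t)%:E).
Proof.
move=> fi gi; rewrite -integral12_prod_meas1; last exact: integrable_prod_sep.
rewrite /fubini_F/=.
under eq_integral => x _.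
  under eq_integral do rewrite EFinM.
  rewrite integralZl//.
  over.
have gf : \int[lebesgue_tuple n]_t (g t)%:E \is a fin_num.
  exact: integrable_fin_num gi.
by rewrite /= -(fineK gf) integralZr.
Qed.

Lemma tnth0_cons_pair n (z : measurableTypeR R * n.-tuple R) :
  tnth (cons_pair z) ord0 = z.1.
Proof. by rewrite tnth0. Qed.

Lemma tnthS_cons_pair n (z : measurableTypeR R * n.-tuple R) i :
  tnth (cons_pair z) (lift ord0 i) = tnth z.2 i.
Proof. by rewrite tnthS. Qed.

(** Integrability and value are proved in one induction, since Fubini's theorem at each step needs
    the integrability of the product over the remaining coordinates. *)
Lemma integral_lebesgue_tuple_prod n (f : 'I_n -> R -> R) :
  (forall i, mu.-integrable setT (EFin \o f i)) ->
  (lebesgue_tuple n).-integrable setT (fun t => (\prod_(i < n) f i (tnth t i))%:E) /\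
  \int[lebesgue_tuple n]_t (\prod_(i < n) f i (tnth t i))%:E =
  (\prod_(i < n) (\int[mu]_x f i x)%R)%:E.
Proof.
elim: n f => [|n IH] f fi.
  have -> : (fun t : 0.-tuple R => (\prod_(i < 0) f i (tnth t i))%:E) = cst 1.
    by apply/funext => t; rewrite big_ord0.
  have L1 : lebesgue_tuple 0 setT = 1 by rewrite /= diracT.
  have I1 : \int[lebesgue_tuple 0]_x cst 1 x = 1.
    by rewrite integral_cst// mul1e; exact: L1.
  split; last by rewrite big_ord0.
  apply/integrableP; split => //=.
  by rewrite (eq_integral (cst 1)) ?I1 ?ltry// => x _; rewrite /= normr1.
have [gi gE] := IH (fun i => f (lift ord0 i)) (fun i => fi _).
set g := fun t : n.-tuple R => _ in gi.
have fE z : (\prod_(i < n.+1) f i (tnth (cons_pair z) i))%:E =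
    (f ord0 z.1 * \prod_(i < n) f (lift ord0 i) (tnth z.2 i))%:E.
  rewrite big_ord_recl tnth0_cons_pair; congr (_ * _)%:E.
  by apply: eq_bigr => i _; rewrite tnthS_cons_pair.
have mP : measurable_fun setT (fun t : n.+1.-tuple R => (\prod_(i < n.+1) f i (tnth t i))%:E).
  apply/measurable_EFinP/measurable_prod => i _.
  apply: (@measurableT_comp _ _ _ _ _ _ (f i)); last exact: measurable_tnth.
  by apply/measurable_EFinP; exact: measurable_int (fi i).
have hi := integrable_prod_sep (fi ord0) gi.
have hE : (fun z => (f ord0 z.1 * \prod_(i < n) f (lift ord0 i) (tnth z.2 i))%:E) =
  (fun t : n.+1.-tuple R => (\prod_(i < n.+1) f i (tnth t i))%:E) \o @cons_pair R n.
  by apply/funext => z /=; rewrite fE.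
have hi' := hi; rewrite hE in hi'.
split; first exact: (integrable_pushforward (@measurable_cons_pair n) mP hi').
rewrite (_ : lebesgue_tuple n.+1 = pushforward (mu \x lebesgue_tuple n) (@cons_pair R n))//.
rewrite (integral_pushforward (@measurable_cons_pair n) mP hi')// preimage_setT -hE.
rewrite (integral_prod_sep (fi ord0) gi) gE big_ord_recl EFinM fineK//.
exact: integrable_fin_num (fi ord0).
Qed.

End lebesgue_tuple_theory.

(** * Euler's identity and Gaussian means of polynomials *)

Section polynomial_algebra.
Context {R : realType} {d : nat}.
Local Open Scope ring_scope.
Implicit Types (P Q : {mpoly R[d]}) (m : multinom d).

Lemma ishomog1E k P m : P \is ishomog1 k mdeg -> m \in msupp P -> mdeg m = k.
Proof. by move=> /dhomogP; apply. Qed.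

Lemma peval_monomial m (x : d.-tuple R) :
  peval (mpolyX R m) x = \prod_(i < d) tnth x i ^+ m i.
Proof. exact: mevalX. Qed.

Lemma euler_homogeneous k P : P \is ishomog1 k mdeg ->
  \sum_(j < d) mpolyX R (mnm1 j) * mderiv j P = k%:R *: P.
Proof.
move=> Pk; rewrite [P in RHS]mpolyE [in LHS](mpolyE P) scaler_sumr.
under eq_bigr do rewrite raddf_sum mulr_sumr.
rewrite exchange_big/= !big_seq; apply: eq_bigr => m mP.
have jE j : mpolyX R (mnm1 j) * mderiv j (mcoeff m P *: mpolyX R m) =
    (mcoeff m P * (m j)%:R) *: mpolyX R m.
  rewrite mderivZ mderivX -scalerAr -scalerAr scalerA -mpolyXD.
  (* For [m j = 0] the truncated difference of exponents is not undone by adding [mnm1 j], but then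
     the coefficient is 0. *)
  case: (posnP (m j)) => [->|mj]; first by rewrite mulr0 !scale0r.
  by congr (_ *: mpolyX _ _); rewrite addmC submK// lep1mP -lt0n.
under eq_bigr do rewrite jE.
by rewrite -scaler_suml -mulr_sumr scalerA mulrC -natr_sum -mdegE (ishomog1E Pk mP).
Qed.

Definition gaussian_mean P : R :=
  \int[lebesgue_tuple d]_x (peval P x * gauss_fun (enorm x)).

(** The left side is what links the weight to the sphere; the right side reduces means of monomials
    to products of [gauss_moment]. *)
Lemma gauss_fun_enorm (x : d.-tuple R) :
  gauss_fun (enorm x) = \prod_(i < d) gauss_fun (tnth x i).
Proof.
rewrite /gauss_fun sqr_sqrtr; last by apply: sumr_ge0 => i _; exact: sqr_ge0.
by rewrite -sumrN expR_sum.
Qed.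

Let monomialE m : (fun x => peval (mpolyX R m) x * gauss_fun (enorm x)) =
  (fun x => \prod_(i < d) (tnth x i ^+ m i * gauss_fun (tnth x i))).
Proof.
by apply/funext => x; rewrite peval_monomial gauss_fun_enorm big_split.
Qed.

Let monomialP m := @integral_lebesgue_tuple_prod R d
  (fun i x => x ^+ m i * gauss_fun x) (fun i => integrable_pow_gauss (m i)).

Lemma integrable_gaussian P : (lebesgue_tuple d).-integrable setT
  (fun x => (peval P x * gauss_fun (enorm x))%:E).
Proof.
elim/mpolyind : P => [|c m P _ _ ih].
  rewrite (_ : (fun x => _) = cst 0%E); first exact: integrable0.
  by apply/funext => x; rewrite /peval meval0 mul0r.
have hm : (lebesgue_tuple d).-integrable setT
    (EFin \o fun x => peval (mpolyX R m) x * gauss_fun (enorm x)).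
  by rewrite monomialE; exact: (monomialP m).1.
have := integrableD measurableT (integrableZl measurableT c hm) ih.
congr (_.-integrable _ _); apply/funext => x /=.
by rewrite -EFinM -EFinD /peval mevalD mevalZ mulrDl mulrA.
Qed.

Lemma gaussian_meanD P Q :
  gaussian_mean (P + Q) = gaussian_mean P + gaussian_mean Q.
Proof.
rewrite -RintegralD//; [|exact: integrable_gaussian..].
by apply: eq_Rintegral => x _; rewrite /peval mevalD mulrDl.
Qed.

Lemma gaussian_meanZ c P : gaussian_mean (c *: P) = c * gaussian_mean P.
Proof.
rewrite -RintegralZl//; last exact: integrable_gaussian.
by apply: eq_Rintegral => x _; rewrite /peval mevalZ mulrA.
Qed.

Lemma gaussian_mean_monomial m :
  gaussian_mean (mpolyX R m) = \prod_(i < d) gauss_moment (m i).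
Proof. by rewrite /gaussian_mean monomialE /Rintegral (monomialP m).2. Qed.

Lemma gaussian_mean_sum (I : Type) (r : seq I) (F : I -> {mpoly R[d]}) :
  gaussian_mean (\sum_(i <- r) F i) = \sum_(i <- r) gaussian_mean (F i).
Proof.
apply: (big_morph _ gaussian_meanD).
by rewrite -(scale0r (0 : {mpoly R[d]})) gaussian_meanZ mul0r.
Qed.

(** By linearity P may be a monomial. Its mean is a product of one-dimensional moments, of which
    only the one with index j changes, according to [gauss_moment_rec]. *)
Lemma gaussian_mean_deriv j P :
  gaussian_mean (mderiv j P) = 2 * gaussian_mean (mpolyX R (mnm1 j) * P).
Proof.
elim/mpolyind : P => [|c m P _ _ ih].
  rewrite mderiv0 mulr0 -(scale0r (0 : {mpoly R[d]})) gaussian_meanZ.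
  by rewrite mul0r mulr0.
rewrite mderivD mulrDr !gaussian_meanD mulrDr -ih; congr (_ + _).
rewrite mderivZ -scalerAr !gaussian_meanZ mulrCA; congr (_ * _).
rewrite mderivX gaussian_meanZ -mpolyXD !gaussian_mean_monomial.
rewrite (bigD1 j)//= [in RHS](bigD1 j)//=.
rewrite mnmBE mnmDE mnm1E eqxx subn1 add1n !mulrA gauss_moment_rec.
congr (_ * _ * _); apply: eq_bigr => i ij.
by rewrite mnmBE mnmDE mnm1E eq_sym (negbTE ij) subn0 add0n.
Qed.

(** An odd total degree forces an odd exponent, and the recursion, started from the vanishing of the
    first moment, kills all odd moments of the line. *)
Lemma gaussian_mean_odd m : odd (mdeg m) -> gaussian_mean (mpolyX R m) = 0.
Proof.
have odd0 k : gauss_moment (R := R) k.*2.+1 = 0.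
  elim: k => [|k ih]; have := gauss_moment_rec (R := R) _.
    by move=> /(_ 0%N)/eqP; rewrite mul0r eq_sym mulf_eq0 pnatr_eq0/= => /eqP.
  move=> /(_ k.*2.+2)/eqP; rewrite /= ih mulr0 eq_sym mulf_eq0 pnatr_eq0/=.
  by rewrite doubleS => /eqP.
rewrite mdegE => om; have [i oi] : exists i, odd (m i).
  apply: contrapT => /forallNP h; move: om; apply/negP; rewrite -dvdn2.
  by apply: dvdn_sum => i _; rewrite dvdn2; exact/negP/h.
rewrite gaussian_mean_monomial (bigD1 i)//= -(odd_double_half (m i)) oi add1n.
by rewrite odd0 mul0r.
Qed.

(* Gaussian integration by parts and Euler's identity evaluate the mean of
   the product of the gradients of P and Q both as 2 n and as 2 k times the
   mean of P Q. *)
Lemma gaussian_mean_harmonic k n P Q : k != n ->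
  harmonic_homogeneous k P -> harmonic_homogeneous n Q ->
  gaussian_mean (P * Q) = 0.
Proof.
have half i j (A B : {mpoly R[d]}) :
    harmonic_homogeneous i A -> harmonic_homogeneous j B ->
    gaussian_mean (\sum_(l < d) mderiv l A * mderiv l B) =
    2 * j%:R * gaussian_mean (A * B).
  move=> [Ai lA] [Bj lB].
  have -> : \sum_(l < d) mderiv l A * mderiv l B =
      \sum_(l < d) mderiv l (A * mderiv l B).
    under [RHS]eq_bigr do rewrite mderivM.
    by rewrite big_split/= -mulr_sumr -[X in _ + A * X]/(laplacian B) lB mulr0 addr0.
  rewrite gaussian_mean_sum; under eq_bigr do rewrite gaussian_mean_deriv mulrCA.
  rewrite -mulr_sumr -gaussian_mean_sum -mulr_sumr (euler_homogeneous Bj).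
  by rewrite -scalerAr gaussian_meanZ mulrA.
move=> kn Pk Qn; have h1 := half _ _ _ _ Pk Qn; have h2 := half _ _ _ _ Qn Pk.
have e : \sum_(l < d) mderiv l Q * mderiv l P = \sum_(l < d) mderiv l P * mderiv l Q.
  by apply: eq_bigr => l _; rewrite mulrC.
move: h2; rewrite e h1 [Q * P]mulrC => /eqP; rewrite -subr_eq0 -mulrBl mulf_eq0.
by rewrite -mulrBr mulf_eq0 pnatr_eq0 subr_eq0 eqr_nat [n == k]eq_sym (negbTE kn) => /eqP.
Qed.

End polynomial_algebra.

(** * Polar coordinates and the surface measure *)

Section polar_coordinates.
Context {R : realType} {d : nat} (d_gt0 : (0 < d)%N).
Notation vol := (@lebesgue_tuple R d).
Notation sphere := (@sphere_measure R d).
Implicit Types (P Q : {mpoly R[d]}) (x : d.-tuple R) (A : set (d.-tuple R)).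

Lemma enorm_ge0 x : (0 <= enorm x)%R. Proof. exact: sqrtr_ge0. Qed.

Lemma norm_tnth_le_enorm x i : (`|tnth x i| <= enorm x)%R.
Proof.
rewrite -sqrtr_sqr; apply: ler_wsqrtr; rewrite (bigD1 i)//= lerDl.
by apply: sumr_ge0 => j _; exact: sqr_ge0.
Qed.

Lemma enorm_scale_norm (r : R) x : enorm (scale_tuple r x) = (`|r| * enorm x)%R.
Proof.
rewrite /enorm -sqrtr_sqr -sqrtrM ?sqr_ge0// mulr_sumr.
by congr Num.sqrt; apply: eq_bigr => i _; rewrite tnth_mktuple exprMn.
Qed.

Lemma enorm_scale (r : R) x : (0 <= r)%R -> enorm (scale_tuple r x) = (r * enorm x)%R.
Proof.
by move=> r0; rewrite enorm_scale_norm ger0_norm.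
Qed.

Lemma scale_scale (r s : R) x : scale_tuple r (scale_tuple s x) = scale_tuple (r * s)%R x.
Proof. by apply: eq_from_tnth => i; rewrite !tnth_mktuple mulrA. Qed.

Lemma direction_scale (r : R) x : (0 < r)%R -> direction (scale_tuple r x) = direction x.
Proof.
move=> r0; rewrite /direction enorm_scale ?(ltW r0)// scale_scale invfM mulrAC.
by rewrite mulVf ?mul1r// gt_eqF.
Qed.

Lemma enorm_eq0 x : (enorm x == 0)%R = [forall i, tnth x i == 0%R].
Proof.
rewrite sqrtr_eq0 le_eqVlt ltNge sumr_ge0 ?orbF; last by move=> i _; exact: sqr_ge0.
rewrite psumr_eq0; last by move=> i _; exact: sqr_ge0.
apply/idP/idP => [/allP h|/forallP h].
  by apply/forallP => i; have := h i (mem_index_enum i); rewrite expf_eq0.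
by apply/allP => i _; rewrite expf_eq0/=; exact: h.
Qed.

Lemma scale_direction x : scale_tuple (enorm x) (direction x) = x.
Proof.
rewrite scale_scale; apply: eq_from_tnth => i; rewrite tnth_mktuple.
have [/eqP|x0] := eqVneq (enorm x) 0%R; last by rewrite divff ?mul1r.
by rewrite enorm_eq0 => /forallP/(_ i)/eqP ->; rewrite mulr0.
Qed.

Lemma enorm_direction x : (enorm x != 0)%R -> enorm (direction x) = 1%R.
Proof. by move=> x0; rewrite enorm_scale ?invr_ge0 ?enorm_ge0// mulVf. Qed.

Lemma peval_scale k P (r : R) x : P \is ishomog1 k mdeg ->
  peval P (scale_tuple r x) = (r ^+ k * peval P x)%R.
Proof.
move=> Pk; rewrite /peval !mevalE mulr_sumr !big_seq; apply: eq_bigr => m mP.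
rewrite -(ishomog1E Pk mP) mdegE mulrCA; congr (_ * _)%R.
rewrite -prodrXr -big_split/=; apply: eq_bigr => i _.
by rewrite tnth_mktuple exprMn.
Qed.

Lemma measurable_peval P : measurable_fun setT (peval P).
Proof.
rewrite (_ : peval P = fun x =>
    (\sum_(m <- msupp P) mcoeff m P * \prod_(i < d) tnth x i ^+ m i)%R); last first.
  by apply/funext => x; exact: mevalE.
apply: measurable_sum => m; apply: measurable_funM => //.
apply: measurable_prod => i _; apply: measurable_funX; exact: measurable_tnth.
Qed.

Let volE A : measurable A -> vol A = \int[vol]_x (\1_A x)%:E.
Proof. by move=> mA; rewrite integral_indic// setIT. Qed.

(** On the ball 1 <= e e^{-|x|^2}, so its volume is bounded by a Gaussian integral. *)
Lemma vol_unit_ball : vol (@unit_ball R d) < +oo.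
Proof.
have h := integrable_gaussian (1 : {mpoly R[d]})%R.
have /integrableP[_] := integrableZl measurableT (expR 1) h.
apply: le_lt_trans.
rewrite volE; last exact: measurable_unit_ball.
apply: ge0_le_integral => //.
- by apply/measurable_EFinP; apply: measurable_indic; exact: measurable_unit_ball.
- by apply: measurableT_comp => //; exact: measurable_int (integrableZl measurableT (expR 1) h).
move=> x _; rewrite /peval meval1 mul1r -EFinM lee_fin ger0_norm; last first.
  by rewrite mulr_ge0 ?expR_ge0.
rewrite indicE; case: (boolP (x \in _)) => [|_]; last by rewrite mulr_ge0 ?expR_ge0.
rewrite inE /unit_ball/= /gauss_fun => x1; rewrite -expRD.
apply: (@le_trans _ _ (expR 0)); first by rewrite expR0.
by rewrite ler_expR subr_ge0 exprn_ile1 ?enorm_ge0.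
Qed.

Lemma measurable_enorm_preimage (C : set R) : measurable C -> measurable (@enorm R d @^-1` C).
Proof. by move=> mC; rewrite -[X in measurable X]setTI; exact: measurable_enorm. Qed.

Lemma measurable_direction_preimage A : measurable A -> measurable (@direction R d @^-1` A).
Proof. by move=> mA; rewrite -[X in measurable X]setTI; exact: measurable_direction. Qed.

Lemma vol_scale (r : R) A : (0 < r)%R -> measurable A ->
  vol A = (r ^+ d)%:E * vol (scale_tuple r @^-1` A).
Proof.
move=> r0 mA; have mrA : measurable (scale_tuple r @^-1` A : set (d.-tuple R)).
  by rewrite -[X in measurable X]setTI; exact: measurable_scale_tuple.
rewrite !volE// (ge0_integral_lebesgue_tuple_scale r0)//.
by apply/measurable_EFinP/measurable_indic.
Qed.

Let cone (C : set R) A := (@enorm R d @^-1` C) `&` (@direction R d @^-1` A).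

Let mcone C A : measurable C -> measurable A -> measurable (cone C A).
Proof.
move=> mC mA; apply: measurableI; first exact: measurable_enorm_preimage.
exact: measurable_direction_preimage.
Qed.

Let vol_cone_scale (r s : R) A : (0 < r)%R -> measurable A ->
  vol (cone `]-oo, (r * s)%R] A) = (r ^+ d)%:E * vol (cone `]-oo, s] A).
Proof.
move=> r0 mA; rewrite (vol_scale r0); last exact: mcone.
congr (_ * vol _); apply/seteqP; split => x []; rewrite /cone/= !in_itv/=.
  by rewrite enorm_scale ?(ltW r0)// ler_pM2l// direction_scale.
by rewrite enorm_scale ?(ltW r0)// ler_pM2l// direction_scale.
Qed.

Let cone_fin (r : R) A : measurable A -> vol (cone `]-oo, r] A) < +oo.
Proof.
move=> mA; have h s : (0 < s)%R -> vol (cone `]-oo, s] A) < +oo.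
  move=> s0; rewrite -[s]mulr1 vol_cone_scale// lte_mul_pinfty ?lee_fin ?exprn_ge0 ?ltW//.
  apply: le_lt_trans vol_unit_ball; apply: le_measure; rewrite ?inE.
  - exact: mcone.
  - exact: measurable_unit_ball.
  - by move=> x []; rewrite /= in_itv.
have [r0|r0] := ltP 0%R r; first exact: h.
apply: le_lt_trans (h 1%R ltr01); apply: le_measure; rewrite ?inE; try exact: mcone.
by move=> x [] /=; rewrite !in_itv/= => xr; split => //=;
  rewrite in_itv/= (le_trans xr)// (le_trans r0).
Qed.

(** The set is invariant under dilation by 2, so its finite volume v satisfies v = 2^d v with d >
    0. *)
Lemma lebesgue_tuple_origin : vol (@enorm R d @^-1` [set 0%R]) = 0.
Proof.
have m0 : measurable (@enorm R d @^-1` [set 0%R]) by exact: measurable_enorm_preimage.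
have : vol (@enorm R d @^-1` [set 0%R]) < +oo.
  apply: le_lt_trans (cone_fin 0%R measurableT); apply: le_measure; rewrite ?inE//.
    exact: mcone.
  by move=> x /= x0; split => //=; rewrite in_itv/= x0.
have := vol_scale (ltr0Sn R 1) m0.
rewrite (_ : scale_tuple _ @^-1` _ = (@enorm R d @^-1` [set 0%R])); last first.
  apply/seteqP; split => x /=; rewrite enorm_scale//.
    by move/eqP; rewrite mulf_eq0 pnatr_eq0/= => /eqP.
  by move->; rewrite mulr0.
have : 0 <= vol (@enorm R d @^-1` [set 0%R]) by [].
case: (vol (@enorm R d @^-1` [set 0%R])) => // v v0 [] /eqP; rewrite -subr_eq0.
rewrite -{1}[v]mul1r -mulrBl mulf_eq0 subr_eq0 => /orP[/eqP e|/eqP ->//] _.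
have : (1 < 2 ^+ d :> R)%R by rewrite exprn_egt1 ?ltr1n// -lt0n.
by rewrite -e ltxx.
Qed.

(** The surface measure without its factor d. *)
Let c A := vol (@direction R d @^-1` A `&` @unit_ball R d).

Let cE A : c A = vol (cone `]-oo, 1%R] A).
Proof.
by rewrite /c setIC; congr (vol (_ `&` _)); apply/seteqP; split => x /=;
  rewrite /unit_ball/= in_itv.
Qed.

Let c_fin A : measurable A -> c A \is a fin_num.
Proof. by move=> mA; rewrite ge0_fin_numE// cE cone_fin. Qed.

(** For r <= 0 the cone lies in the negligible origin, and the right side is 0 because 0^d = 0 for d
    > 0; hence the truncation [Num.max r 0]. *)
Let vol_ray (r : R) A : measurable A ->
  vol (cone `]-oo, r] A) = (Num.max r 0 ^+ d)%:E * c A.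
Proof.
move=> mA; have [r0|r0] := ltP 0%R r.
  by rewrite cE -[in LHS](mulr1 r) vol_cone_scale.
rewrite expr0n eqn0Ngt d_gt0/= mul0e; apply: subset_measure0 lebesgue_tuple_origin.
- exact: mcone.
- exact: measurable_enorm_preimage.
- move=> x []; rewrite /= in_itv/= => xr _; apply/eqP.
  by rewrite eq_le enorm_ge0 (le_trans xr).
Qed.

(* In C, both sides are measures, and by scaling they agree on the half-lines ]-oo, b]. *)
Let cone_proportional C A : measurable C -> measurable A ->
  c setT * vol (cone C A) = c A * vol (cone C setT).
Proof.
move=> mC mA.
have mD := measurable_direction_preimage mA.
pose cT : {nonneg R} := NngNum (fine_ge0 (measure_ge0 vol _ : 0 <= c setT)).
pose cA : {nonneg R} := NngNum (fine_ge0 (measure_ge0 vol _ : 0 <= c A)).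
pose kA := measure_function_pushforward__canonical__measure_function_Measure
  (mrestr vol mD) (@measurable_enorm R d).
pose kT := measure_function_pushforward__canonical__measure_function_Measure
  vol (@measurable_enorm R d).
suff : mscale cT kA C = mscale cA kT C.
  rewrite /mscale/= !fineK ?c_fin// => h.
  rewrite /cone preimage_setT setIT; exact: h.
have m1 a b : mscale cT kA `]a, b]%classic = mscale cA kT `]a, b]%classic.
  have [ab|ba] := leP a b; last first.
    by rewrite set_itv_ge ?measure0// bnd_simp -leNgt ltW.
  (* Half-open intervals are differences of half-lines; since all volumes are finite,
     proportionality passes to them by subtraction. *)
  have sub B : measurable B -> vol (cone `]-oo, b] B) =
      vol (cone `]-oo, a] B) + vol (cone `]a, b] B).
    move=> mB; rewrite -measureU; [|exact: mcone..|]; last first.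
      apply/seteqP; split => // x [] [] /=; rewrite !in_itv/= => xa _ [] /andP[].
      by rewrite bnd_simp ltNge xa.
    congr (vol _); apply/seteqP; split => x.
      move=> [] /=; rewrite !in_itv/= => xb Bx.
      by have [xa|xa] := leP (enorm x) a; [left|right]; split => //=; rewrite in_itv/= ?xa.
    move=> [[/= + Bx]|[/= + Bx]]; rewrite in_itv/= => xa; split => //=; rewrite in_itv/=.
      exact: le_trans ab.
    by case/andP: xa.
  rewrite /mscale/= !fineK ?c_fin//.
  have <- : vol (cone `]a, b] setT) = kT `]a, b]%classic.
    by rewrite /cone preimage_setT setIT.
  have <- : vol (cone `]a, b] A) = kA `]a, b]%classic by [].
  move: (sub _ mA) (sub _ measurableT) (cone_fin a mA) (cone_fin a measurableT)
    (c_fin mA) (c_fin measurableT).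
  rewrite !vol_ray//.
  have : 0 <= vol (cone `]a, b] A) by [].
  have : 0 <= vol (cone `]a, b] setT) by [].
  case: (c A) (c setT) => [u| |] [v| |]//.
  case: (vol (cone _ A)) (vol (cone _ setT)) => [s| |] [t| |]// _ _ [e1] [e2] _ _ _ _.
  by congr EFin; nra.
apply: (measure_unique (@ocitv R) (fun n => `]- n%:R, n%:R]%classic)%R) => //.
- exact: ocitvI.
- by move=> n; exact: is_ocitv.
- exact: bigcup_itvT.
- by move=> _ [[a b] _ <-]; exact: m1.
- move=> n.
  rewrite [X in X < _](_ : _ = c setT * kA `](- n%:R)%R, n%:R%R]%classic); last first.
    by rewrite -[c setT in RHS](fineK (c_fin measurableT)).
  rewrite lte_mul_pinfty//; first exact: c_fin.
  have -> : kA `](- n%:R)%R, n%:R%R]%classic = vol (cone `](- n%:R)%R, n%:R%R] A) by [].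
  apply: le_lt_trans (cone_fin n%:R mA); apply: le_measure; rewrite ?inE//.
  - by apply: mcone => //; exact: measurable_itv.
  - by apply: mcone => //; exact: measurable_itv.
  - by move=> x [] /=; rewrite !in_itv/= => /andP[_ xn] Ax; split => //=; rewrite in_itv.
Qed.

Let sphereE A : sphere A = d%:R%:E * c A. Proof. by []. Qed.

Lemma sphere_setT_lty : sphere setT < +oo.
Proof. by rewrite sphereE lte_mul_pinfty ?lee_fin// -ge0_fin_numE// c_fin. Qed.

(** Under x |-> x / |x| the measure g(|x|) dx becomes a multiple of the surface measure. Both total
    masses are kept as factors, which avoids dividing by a quantity not yet known to be positive. *)
Lemma ge0_integral_polar (g : R -> R) (h : d.-tuple R -> \bar R) :
  measurable_fun setT g -> (forall r, (0 <= g r)%R) ->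
  \int[vol]_x (g (enorm x))%:E < +oo ->
  measurable_fun setT h -> (forall x, 0 <= h x) ->
  sphere setT * \int[vol]_x (h (direction x) * (g (enorm x))%:E) =
  \int[vol]_x (g (enorm x))%:E * \int[sphere]_x h x.
Proof.
move=> mg g0 goo mh h0.
have mge : measurable_fun setT (fun x => g (enorm x)).
  exact: (measurableT_comp mg (@measurable_enorm R d)).
have [rho rhoE] := @exists_density _ _ R vol setT (fun x => g (enorm x))
  measurableT mge (fun x _ => g0 _).
pose rho' := measure_function_pushforward__canonical__measure_function_Measure
  rho (@measurable_direction R d).
pose cT : {nonneg R} := NngNum (fine_ge0 (measure_ge0 sphere _ : 0 <= sphere setT)).
have K0 : 0 <= \int[vol]_x (g (enorm x))%:E.
  by apply: integral_ge0 => x _; rewrite lee_fin.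
pose K : {nonneg R} := NngNum (fine_ge0 K0).
have cTE : (cT%:num)%:E = sphere setT by rewrite fineK// ge0_fin_numE// sphere_setT_lty.
have KE : (K%:num)%:E = \int[vol]_x (g (enorm x))%:E.
  by rewrite fineK// ge0_fin_numE.
have E A : measurable A -> mscale cT rho' A = mscale K sphere A.
  move=> mA; rewrite /mscale/= cTE KE /pushforward.
  have mD := measurable_direction_preimage mA.
  (* For fixed [A], the measures [kA] and [kT] are the laws of |x| under Lebesgue measure on the
     cone over [A] and on the whole space. They are proportional by [cone_proportional], and g is
     integrated against both. *)
  have [lam lamE] := @exists_density _ _ R vol _ (cst 1%R) mD
    (measurable_cst _) (fun _ _ => ler01).
  have lamV B : measurable B -> lam B = vol (B `&` @direction R d @^-1` A).
    move=> mB.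
    transitivity (\int[lam]_x (\1_B x)%:E); first by rewrite integral_indic// setIT.
    rewrite lamE//; last by apply/measurable_EFinP/measurable_indic.
    under eq_integral do rewrite mule1.
    by rewrite integral_indic.
  pose kA := measure_function_pushforward__canonical__measure_function_Measure
    lam (@measurable_enorm R d).
  pose kT := measure_function_pushforward__canonical__measure_function_Measure
    vol (@measurable_enorm R d).
  pose uT : {nonneg R} := NngNum (fine_ge0 (measure_ge0 vol _ : 0 <= c setT)).
  pose uA : {nonneg R} := NngNum (fine_ge0 (measure_ge0 vol _ : 0 <= c A)).
  have prop C : measurable C -> mscale uT kA C = mscale uA kT C.
    move=> mC; rewrite /mscale/= !fineK ?c_fin// /pushforward lamV//; last first.
      exact: measurable_enorm_preimage.
    by have := cone_proportional mC mA; rewrite /cone preimage_setT setIT.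
  have mg' : measurable_fun setT (EFin \o g) by exact/measurable_EFinP.
  have : \int[mscale uT kA]_r (g r)%:E = \int[mscale uA kT]_r (g r)%:E.
    by apply: eq_measure_integral => C mC _; exact: prop.
  have g0' r : setT r -> 0 <= (g r)%:E by rewrite lee_fin.
  have g0'' : {in [set: R], forall r : R, 0 <= (g r)%:E}.
    by move=> r _; rewrite lee_fin.
  have -> : \int[mscale uT kA]_r (g r)%:E =
      c setT * \int[vol]_(x in @direction R d @^-1` A) (g (enorm x))%:E.
    rewrite ge0_integral_mscale//= fineK ?c_fin//; congr (_ * _).
    rewrite (ge0_integral_pushforward (@measurable_enorm R d))//= ?preimage_setT.
    rewrite lamE; [|exact/measurable_EFinP|by move=> x; rewrite lee_fin].
    by under eq_integral do rewrite mule1.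
  have -> : \int[mscale uA kT]_r (g r)%:E = c A * \int[vol]_x (g (enorm x))%:E.
    rewrite ge0_integral_mscale//= fineK ?c_fin//; congr (_ * _).
    by rewrite (ge0_integral_pushforward (@measurable_enorm R d)).
  move=> e; have rhoV : rho (@direction R d @^-1` A) =
      \int[vol]_(x in @direction R d @^-1` A) (g (enorm x))%:E.
    transitivity (\int[rho]_x (\1_(@direction R d @^-1` A) x)%:E).
      by rewrite integral_indic// setIT.
    rewrite rhoE//; last by apply/measurable_EFinP/measurable_indic.
    rewrite [RHS]integral_mkcond; apply: eq_integral => x _.
    by rewrite patchE indicE; case: (x \in _); rewrite ?mul1e ?mul0e.
  by rewrite rhoV sphereE (sphereE A) -muleA e muleA [RHS]muleC.
rewrite -cTE -KE.
have -> : \int[vol]_x (h (direction x) * (g (enorm x))%:E) = \int[rho']_x h x.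
  rewrite (ge0_integral_pushforward (@measurable_direction R d))// preimage_setT rhoE//.
    exact: (measurableT_comp mh (@measurable_direction R d)).
  by move=> x; exact: h0.
rewrite -!ge0_integral_mscale//.
by apply: eq_measure_integral => A mA _; exact: E.
Qed.

(** [sphere_measure] is a measure on the whole space, and [direction] sends the origin to the
    origin. This is the only point not sent to norm 1, and it is negligible. *)
Lemma sphere_ae_norm1 : {ae sphere, forall x, enorm x = 1%R}.
Proof.
pose N := ~` (@enorm R d @^-1` [set 1%R]).
have mN : measurable N by apply: measurableC; exact: measurable_enorm_preimage.
exists N; split => //.
rewrite sphereE (_ : c N = 0) ?mule0//; apply: subset_measure0 lebesgue_tuple_origin.
- apply: measurableI; last exact: measurable_unit_ball.
  exact: measurable_direction_preimage.
- exact: measurable_enorm_preimage.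
- move=> x [] /= xN _; apply: contrapT => /eqP x0.
  by apply: xN; exact: enorm_direction.
Qed.

Lemma integrable_sphere_bounded (f : d.-tuple R -> R) (C : R) :
  measurable_fun setT f -> (forall x, (enorm x <= 1)%R -> (`|f x| <= C)%R) ->
  sphere.-integrable setT (EFin \o f).
Proof.
move=> mf fC; apply/integrableP; split; first exact/measurable_EFinP.
apply: (@le_lt_trans _ _ (\int[sphere]_x (`|C|)%:E)); last first.
  by rewrite integral_cst// lte_mul_pinfty ?lee_fin// sphere_setT_lty.
apply: ae_ge0_le_integral => //.
  by apply: measurableT_comp => //; exact/measurable_EFinP.
apply: filterS sphere_ae_norm1 => x x1 _; rewrite /= lee_fin.
by apply: le_trans (ler_norm _); apply: fC; rewrite x1.
Qed.

Lemma peval_bounded P : exists C : R, forall x, (enorm x <= 1)%R -> (`|peval P x| <= C)%R.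
Proof.
exists (\sum_(m <- msupp P) `|mcoeff m P|)%R => x x1.
rewrite /peval mevalE; apply: (le_trans (ler_norm_sum _ _ _)); apply: ler_sum => m _.
rewrite normrM ler_piMr// normr_prod; apply: prodr_ile1 => i _.
by rewrite normr_ge0 normrX exprn_ile1// (le_trans (norm_tnth_le_enorm x i)).
Qed.

Lemma integrable_sphere_peval P : sphere.-integrable setT (EFin \o peval P).
Proof.
by have [C hC] := peval_bounded P; apply: integrable_sphere_bounded hC; exact: measurable_peval.
Qed.

(** By homogeneity P(x) e^{-|x|^2} = P(x/|x|) g(|x|) with g(r) = |r|^k e^{-r^2}. The polar formula
    then equates the mass of g(|x|) dx times the spherical integral of P with the area times the
    Gaussian mean, which is 0. *)
Lemma integral_sphere_homogeneous k P : P \is ishomog1 k mdeg ->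
  gaussian_mean P = 0%R -> (\int[sphere]_x peval P x = 0)%R.
Proof.
move=> Pk P0.
pose g (r : R) : R := (`|r| ^+ k * gauss_fun r)%R.
have mg : measurable_fun setT g.
  apply: measurable_funM; last exact: measurable_gauss_fun.
  by apply: measurable_funX; exact: normr_measurable.
have g0 r : (0 <= g r)%R by rewrite mulr_ge0 ?exprn_ge0 ?expR_ge0.
have goo : \int[vol]_x (g (enorm x))%:E < +oo.
  (* [Q] evaluates to 1 + |x|^(2k), which dominates |x|^k since t <= 1 + t^2. *)
  pose Q : {mpoly R[d]} := (1 + (\sum_(i < d) mpolyX R (mnm1 i) ^+ 2) ^+ k)%R.
  have /integrableP[_] := integrable_gaussian Q.
  apply: le_lt_trans; apply: ge0_le_integral => //.
  - by move=> x _; rewrite lee_fin.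
  - by apply/measurable_EFinP; exact: (measurableT_comp mg (@measurable_enorm R d)).
  - by apply: measurableT_comp => //; exact: measurable_int (integrable_gaussian Q).
  move=> x _; rewrite lee_fin normrM /g (ger0_norm (expR_ge0 _)).
  rewrite ler_wpM2r ?expR_ge0// (ger0_norm (enorm_ge0 _)).
  have -> : peval Q x = (1 + (enorm x ^+ k) ^+ 2)%R.
    rewrite /peval mevalD meval1 rmorphXn; congr (_ + _)%R.
    rewrite -exprM mulnC exprM sqr_sqrtr; last by apply: sumr_ge0 => i _; exact: sqr_ge0.
    by rewrite raddf_sum/=; congr (_ ^+ k)%R; apply: eq_bigr => i _; rewrite rmorphXn/= mevalXU.
  by apply: le_trans (ler_norm _); set y := (_ ^+ _)%R; nra.
have Sfin : sphere setT \is a fin_num by rewrite ge0_fin_numE// sphere_setT_lty.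
have Kfin : \int[vol]_x (g (enorm x))%:E \is a fin_num.
  by rewrite ge0_fin_numE// integral_ge0// => x _; rewrite lee_fin.
have iP := integrable_sphere_peval P.
have mP : measurable_fun setT (EFin \o peval P) by exact: measurable_int iP.
pose p x := (peval P (direction x) * g (enorm x))%R.
have pE x : p x = (peval P x * gauss_fun (enorm x))%R.
  rewrite /p /g ger0_norm ?enorm_ge0// mulrA; congr (_ * _)%R.
  by rewrite -[X in _ = peval P X]scale_direction (peval_scale _ _ Pk) mulrC.
have ip : vol.-integrable setT (EFin \o p).
  by rewrite (funext pE); exact: integrable_gaussian P.
have I0 : \int[vol]_x (EFin \o p) x = 0.
  have := integrable_fin_num measurableT ip.
  move: P0; rewrite /gaussian_mean /Rintegral.
  under eq_integral do rewrite -pE.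
  by rewrite -[X in fine X]/(\int[vol]_x (EFin \o p) x); case: integral => //= r ->.
have : \int[vol]_x (g (enorm x))%:E * \int[sphere]_x (peval P x)%:E = 0.
  rewrite [X in _ * X]integralE muleBr//; last first.
    by rewrite fin_num_adde_defl// fin_numN; exact: integrable_neg_fin_num iP.
  rewrite -!(ge0_integral_polar mg g0 goo)//; last 2 first.
    exact: measurable_funeneg.
    exact: measurable_funepos.
  have pos : \int[vol]_x ((EFin \o peval P)^\+ (direction x) * (g (enorm x))%:E) =
      \int[vol]_x (EFin \o p)^\+ x.
    apply: eq_integral => x _; rewrite !funeposE /p/= mulrC EFinM.
    by rewrite [LHS]muleC maxe_pMr ?mule0 ?lee_fin ?g0.
  have neg : \int[vol]_x ((EFin \o peval P)^\- (direction x) * (g (enorm x))%:E) =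
      \int[vol]_x (EFin \o p)^\- x.
    apply: eq_integral => x _; rewrite !funenegE /p/= -mulNr mulrC EFinM.
    by rewrite [LHS]muleC maxe_pMr ?mule0 ?lee_fin ?g0.
  rewrite pos neg -muleBr//; last first.
    by rewrite fin_num_adde_defl// fin_numN; exact: integrable_neg_fin_num ip.
  by rewrite -integralE I0 mule0.
move/eqP; rewrite mule_eq0 => /orP[/eqP K0|/eqP e]; last by rewrite /Rintegral e.
(* If the mass of g(|x|) dx is 0, then the complement of the origin, where g(|x|) > 0, is a null
   set; the surface measure is then zero, and the integral vanishes in this case too. *)
suff cT0 : c setT = 0.
  by rewrite /Rintegral null_set_integral//= -[LHS]/(sphere setT) sphereE cT0 mule0.
have /ae_eq_integral_abs : measurable_fun setT (fun x => (g (enorm x))%:E).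
  by apply/measurable_EFinP; exact: (measurableT_comp mg (@measurable_enorm R d)).
move=> /(_ vol measurableT)[+ _]; case.
  by rewrite -[RHS]K0; apply: eq_integral => x _; rewrite gee0_abs// lee_fin.
move=> N [mN N0 subN]; apply: (@subset_measure0 _ _ _ _ _ (N `|` @enorm R d @^-1` [set 0%R])).
- apply: measurableI; last exact: measurable_unit_ball.
  exact: measurable_direction_preimage.
- by apply: measurableU => //; exact: measurable_enorm_preimage.
- move=> x _; have [x0|x0] := eqVneq (enorm x) 0%R; [by right|left].
  apply: subN => /= /(_ I) [] /eqP; apply/negP.
  by rewrite mulf_neq0 ?expf_neq0 ?normr_eq0// gt_eqF// expR_gt0.
- have m0 : measurable (@enorm R d @^-1` [set 0%R]) by exact: measurable_enorm_preimage.
  by have /= -> := @measureU0 _ _ _ vol _ _ mN m0 lebesgue_tuple_origin.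
Qed.

End polar_coordinates.

(** * Orthogonality on the sphere, and functions of polynomial growth *)

Section sphere_orthogonality.
Context {R : realType} {d : nat} (d_gt0 : (0 < d)%N).
Implicit Types P Q : {mpoly R[d]}.

Lemma sphere_harmonic_orthogonal k n P Q : k != n ->
  harmonic_homogeneous k P -> harmonic_homogeneous n Q ->
  (\int[sphere_measure d]_x (peval P x * peval Q x) = 0)%R.
Proof.
move=> kn Pk Qn; rewrite -(integral_sphere_homogeneous d_gt0 (dhomogM Pk.1 Qn.1)).
  by apply: eq_Rintegral => x _; rewrite /peval mevalM.
exact: gaussian_mean_harmonic kn Pk Qn.
Qed.

Lemma sphere_integral_odd_monomial (m : multinom d) : odd (mdeg m) ->
  (\int[sphere_measure d]_x peval (mpolyX R m) x = 0)%R.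
Proof.
move=> om; apply: (integral_sphere_homogeneous d_gt0 (k := mdeg m)).
  by rewrite dhomogX.
exact: gaussian_mean_odd.
Qed.

End sphere_orthogonality.

(** One class for both uses of the measure: polynomials, for the moments, and h(|x|) Y_{k,l}(x), for
    pseudo-positivity. It is stable under positive and negative parts and controlled by the moments
    of the radial measures. *)
Definition poly_growth {R : realType} {d : nat} (f : d.-tuple R -> R) :=
  measurable_fun setT f /\ exists (C : R) (N : nat), (0 <= C)%R /\
    forall x, (`|f x| <= C * (1 + enorm x ^+ N))%R.

Lemma integral_eq_measure d (T : measurableType d) (R : realType)
    (m1 m2 : {measure set T -> \bar R}) (h : T -> \bar R) :
  m1 = m2 :> (_ -> _) -> \int[m1]_x h x = \int[m2]_x h x.
Proof. by move=> m12; apply: eq_measure_integral => A _ _; rewrite m12. Qed.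

(** The Laplace-Fourier coefficient of a real function that need not be a polynomial. *)
Definition sphere_coeff {R : realType} {d : nat} (P : {mpoly R[d]})
    (f : d.-tuple R -> R) (r : R) : R :=
  (\int[sphere_measure d]_x (f (scale_tuple r x) * peval P x))%R.

Section polynomial_growth.
Context {R : realType} {d : nat}.
Implicit Types f g : d.-tuple R -> R.

Lemma poly_growth_le f g : measurable_fun setT g -> (forall x, (`|g x| <= `|f x|)%R) ->
  poly_growth f -> poly_growth g.
Proof.
move=> mg gf [_ [C [N [C0 h]]]]; split => //; exists C, N; split => // x.
exact: le_trans (gf x) (h x).
Qed.

Lemma poly_growth_peval (P : {mpoly R[d]}) : poly_growth (peval P).
Proof.
split; first exact: measurable_peval.
pose N := (\max_(m <- msupp P) mdeg m)%N.
exists (\sum_(m <- msupp P) `|mcoeff m P|)%R, N; split.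
  by apply: sumr_ge0.
move=> x; rewrite /peval mevalE mulr_suml; apply: (le_trans (ler_norm_sum _ _ _)).
rewrite !big_seq; apply: ler_sum => m mP; rewrite normrM ler_wpM2l//.
apply: (@le_trans _ _ (enorm x ^+ mdeg m)%R).
  rewrite normr_prod mdegE -prodrXr; apply: ler_prod => i _.
  by rewrite normr_ge0 normrX lerXn2r ?nnegrE ?enorm_ge0// norm_tnth_le_enorm.
have mN : (mdeg m <= N)%N by rewrite /N (big_rem m)//= leq_max leqnn.
have [x1|x1] := leP (enorm x) 1%R.
  rewrite -[leLHS]addr0 lerD ?exprn_ge0 ?enorm_ge0//.
  by rewrite exprn_ile1 ?enorm_ge0.
by apply: (@le_trans _ _ (enorm x ^+ N)%R); [rewrite ler_weXn2l// ltW|rewrite lerDr].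
Qed.

Lemma integrable_sphere_scale (d_gt0 : (0 < d)%N) f (P : {mpoly R[d]}) (r : R) :
  poly_growth f -> (sphere_measure d).-integrable setT
    (EFin \o (fun x => f (scale_tuple r x) * peval P x)%R).
Proof.
case=> mf [C [N [C0 fC]]]; have [B PB] := peval_bounded P.
apply: (integrable_sphere_bounded d_gt0 (C := C * (1 + `|r| ^+ N) * B)%R).
  apply: measurable_funM; last exact: measurable_peval.
  exact: (measurableT_comp mf (measurable_scale_tuple r)).
move=> x x1; rewrite normrM ler_pM//; last exact: PB.
apply: (le_trans (fC _)); rewrite ler_wpM2l// lerD2l enorm_scale_norm.
by rewrite lerXn2r ?nnegrE ?mulr_ge0 ?enorm_ge0// ler_piMr.
Qed.

End polynomial_growth.

(** * Integrals over (r, theta); [S] is the surface measure packaged as a finite measure *)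

Section sphere_product.
Context {R : realType} {d : nat} (d_gt0 : (0 < d)%N).
Variables (tau : {finite_measure set R -> \bar R})
          (S : {finite_measure set (d.-tuple R) -> \bar R}).
Hypothesis SE : S = sphere_measure d :> (_ -> _).
Hypothesis tau_moment : forall N, \int[tau]_r (1 + `|r| ^+ N)%:E < +oo.
Implicit Types (P : {mpoly R[d]}) (f : d.-tuple R -> R).

Let SI (h : d.-tuple R -> \bar R) : \int[S]_x h x = \int[sphere_measure d]_x h x.
Proof. exact: integral_eq_measure SE. Qed.

Definition radial_product (z : R * d.-tuple R) : d.-tuple R := scale_tuple z.1 z.2.

Lemma measurable_radial_product : measurable_fun setT radial_product.
Proof.
apply/measurable_fun_tnthP => i.
rewrite (_ : _ \o _ = fun z : R * d.-tuple R => (z.1 * tnth z.2 i)%R).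
  apply: measurable_funM; first exact: measurable_fst.
  exact: (measurableT_comp (measurable_tnth i) measurable_snd).
by apply/funext => z /=; rewrite tnth_mktuple.
Qed.

Lemma measurable_radial_peval f P : measurable_fun setT f ->
  measurable_fun setT (fun z => f (radial_product z) * peval P z.2)%R.
Proof.
move=> mf; apply: measurable_funM.
  exact: (measurableT_comp mf measurable_radial_product).
exact: (measurableT_comp (measurable_peval P) measurable_snd).
Qed.

(** Since |theta| = 1 almost everywhere, |f(r theta)| <= C (1 + |r|^N). The factor P enters through
    its L^1 norm and not through its supremum, because later only the integral is bounded uniformly
    in k and l. *)
Lemma integral_radial_le f P (C : R) N : measurable_fun setT f -> (0 <= C)%R ->
  (forall x, (`|f x| <= C * (1 + enorm x ^+ N))%R) ->
  \int[tau]_r \int[S]_x `|f (scale_tuple r x) * peval P x|%:E <=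
  \int[tau]_r (1 + `|r| ^+ N)%:E * (C%:E * \int[S]_x `|peval P x|%:E).
Proof.
move=> mf C0 fC.
have mP := measurable_peval P.
have mr : measurable_fun setT (fun r : R => (1 + `|r| ^+ N)%:E).
  apply/measurable_EFinP/measurable_funD => //.
  by apply: measurable_funX; exact: normr_measurable.
have mF : measurable_fun setT (fun z => `|f (radial_product z) * peval P z.2|%:E).
  by apply/measurable_EFinP/measurableT_comp => //; exact: measurable_radial_peval.
have mPa : measurable_fun setT (fun x : d.-tuple R => `|peval P x|%:E).
  by apply/measurable_EFinP; exact: measurableT_comp.
rewrite -ge0_integralZr//; last first.
  by rewrite mule_ge0// ?lee_fin// integral_ge0// => x _; rewrite lee_fin.
apply: ge0_le_integral => //.
- by move=> r _; apply: integral_ge0 => x _; rewrite lee_fin.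
- exact: (measurable_fun_fubini_tonelli_F (m2 := S)
    (fun z => `|f (radial_product z) * peval P z.2|%:E)).
- by apply: emeasurable_funM.
move=> r _; rewrite muleA -EFinM -ge0_integralZl//; last first.
  by rewrite lee_fin mulr_ge0// addr_ge0// exprn_ge0.
rewrite !SI; apply: ae_ge0_le_integral => //.
- exact: (measurableT_comp mF (pair1_measurable r)).
- by move=> x _; rewrite mule_ge0 ?lee_fin ?mulr_ge0// addr_ge0// exprn_ge0.
- exact: emeasurable_funM.
apply: filterS (sphere_ae_norm1 d_gt0) => x x1 _.
rewrite -EFinM lee_fin normrM ler_wpM2r// mulrC; apply: (le_trans (fC _)).
by rewrite enorm_scale_norm x1 mulr1.
Qed.

Lemma integrable_radial f P : poly_growth f ->
  (tau \x S).-integrable setT (fun z => (f (radial_product z) * peval P z.2)%:E).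
Proof.
move=> [mf [C [N [C0 fC]]]]; apply/integrable12ltyP.
  by apply/measurable_EFinP; exact: measurable_radial_peval.
rewrite (_ : integral _ _ _ =
    \int[tau]_r \int[S]_x `|f (scale_tuple r x) * peval P x|%:E)//.
apply: (le_lt_trans (integral_radial_le P mf C0 fC)).
have /integrableP[_] := integrable_sphere_peval d_gt0 P.
rewrite -SI => iP; rewrite lte_mul_pinfty ?integral_ge0//.
- by rewrite ge0_fin_numE ?tau_moment// integral_ge0.
- by rewrite lte_mul_pinfty ?lee_fin.
Qed.

Lemma Rintegral_radial f P : poly_growth f ->
  (\int[tau \x S]_z (f (radial_product z) * peval P z.2) =
   \int[tau]_r sphere_coeff P f r)%R.
Proof.
move=> gf; rewrite {1}/Rintegral -integral12_prod_meas1; last exact: integrable_radial.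
rewrite /fubini_F /Rintegral /sphere_coeff; congr fine; apply: eq_integral => r _.
by rewrite SI fineK//; exact: integrable_fin_num (integrable_sphere_scale d_gt0 P r gf).
Qed.

Lemma measurable_sphere_coeff f P : poly_growth f ->
  measurable_fun setT (sphere_coeff P f).
Proof.
move=> gf; have := measurable_fubini_F (integrable_radial P gf).
move=> /(measurableT_comp (fine_measurable measurableT)); apply: eq_measurable_fun => r _.
by rewrite /sphere_coeff /Rintegral -SI.
Qed.

Lemma Rintegral_radial_density (sigma : {measure set R -> \bar R}) k f P :
  (forall h : R -> \bar R, measurable_fun setT h -> (forall r, 0 <= h r) ->
    \int[tau]_r h r = \int[sigma]_(r in `[0%R, +oo[) (h r * (r ^- k)%:E)) ->
  poly_growth f ->
  (\int[tau \x S]_z (f (radial_product z) * peval P z.2) =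
   \int[sigma]_(r in `[0, +oo[) (sphere_coeff P f r * r ^- k))%R.
Proof.
move=> tauE gf; rewrite Rintegral_radial// /Rintegral; congr fine.
apply: (density_integral_EFin _ tauE); last exact: measurable_sphere_coeff.
by move=> r; rewrite /= in_itv/= andbT => r0; rewrite invr_ge0 exprn_ge0.
Qed.

End sphere_product.

Lemma le_term_nneseries {R : realType} (u : (\bar R)^nat) k :
  (forall n, 0 <= u n) -> u k <= \sum_(0 <= n <oo) u n.
Proof.
move=> u0; apply: (@le_trans _ _ (\sum_(0 <= n < k.+1) u n)).
  by rewrite big_nat_recr//= leeDr// sume_ge0.
exact: nneseries_lim_ge.
Qed.

(** * Countable sums of images of positive densities *)

Section weighted_sum.
Context {R : realType} {d : nat} (d_gt0 : (0 < d)%N) (a : nat -> nat).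
Variables (S : {finite_measure set (d.-tuple R) -> \bar R}).
Hypothesis SE : S = sphere_measure d :> (_ -> _).
Variable tau : forall k, 'I_(a k) -> {finite_measure set R -> \bar R}.
Hypothesis tau_sum : forall N,
  \sum_(0 <= k <oo) \sum_(l < a k) \int[tau l]_r (1 + `|r| ^+ N)%:E < +oo.

Let moment N k l := \int[@tau k l]_r (1 + `|r| ^+ N)%:E.

Let moment_ge0 N k (l : 'I_(a k)) : 0 <= moment N l.
Proof. by apply: integral_ge0 => r _; rewrite lee_fin addr_ge0// exprn_ge0. Qed.

Lemma tau_moment_lty k (l : 'I_(a k)) N : \int[tau l]_r (1 + `|r| ^+ N)%:E < +oo.
Proof.
apply: le_lt_trans (tau_sum N).
apply: (@le_trans _ _ (\sum_(i < a k) moment N i)).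
  by rewrite (bigD1 l)//= leeDl// sume_ge0.
by apply: (@le_term_nneseries _ (fun k => \sum_(i < a k) moment N i)) => n; exact: sume_ge0.
Qed.

Variable u : forall k, 'I_(a k) -> {mpoly R[d]}.
Hypothesis u_ge0 : forall k (l : 'I_(a k)) x, (0 <= peval (u l) x)%R.
Variable B : R.
Hypothesis B_ge0 : (0 <= B)%R.
Hypothesis u_le : forall k (l : 'I_(a k)), \int[sphere_measure d]_x (peval (u l) x)%:E <= B%:E.

Let part (f : d.-tuple R -> R) k (l : 'I_(a k)) : R :=
  (\int[tau l \x S]_z (f (radial_product z) * peval (u l) z.2))%R.

(** Each pair (k, l) contributes the image under (r, theta) |-> r theta of the product measure with
    density [u l]. For f >= 0 the convergence is that of a series of nonnegative terms; the general
    case follows by positive and negative parts, again of polynomial growth. *)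
Lemma exists_weighted_sum : exists M : {finite_measure set (d.-tuple R) -> \bar R},
  forall f : d.-tuple R -> R, poly_growth f ->
    M.-integrable setT (EFin \o f) /\
    ((\sum_(0 <= k < n) \sum_(l < a k) part f l)%R @[n --> \oo] -->
      (\int[M]_x f x)%R).
Proof.
have mu_ k (l : 'I_(a k)) : measurable_fun setT (fun z : R * d.-tuple R => peval (u l) z.2).
  exact: (measurableT_comp (measurable_peval (u l)) measurable_snd).
have /choice[m mE] : forall kl : {k & 'I_(a k)},
    exists m : {measure set (d.-tuple R) -> \bar R},
    forall h : d.-tuple R -> \bar R, measurable_fun setT h -> (forall x, 0 <= h x) ->
    \int[m]_x h x = \int[tau (tagged kl) \x S]_z
      (h (radial_product z) * (peval (u (tagged kl)) z.2)%:E).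
  move=> [k l] /=.
  have [w wE] := @exists_density _ _ R (tau l \x S) setT
    (fun z => peval (u l) z.2) measurableT (mu_ k l) (fun z _ => u_ge0 l _).
  exists (measure_function_pushforward__canonical__measure_function_Measure w
    (@measurable_radial_product R d)) => h mh h0.
  rewrite (ge0_integral_pushforward (@measurable_radial_product R d))//.
  rewrite preimage_setT wE//.
    exact: (measurableT_comp mh (@measurable_radial_product R d)).
  by move=> z; exact: h0.
have [M0 M0E] := @exists_measure_sum _ _ R a (fun k l => m (Tagged (fun k => 'I_(a k)) l)).
(* The same estimate, C B times the sum of the moments, gives the integrability of f and, for f = 1,
   the finiteness of the measure. *)
have M0fin f : poly_growth f -> \int[M0]_x `|f x|%:E < +oo.
  move=> gf; have [mf [C [N [C0 fC]]]] := gf.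
  have mfa : measurable_fun setT (fun x => `|f x|%:E).
    by apply/measurable_EFinP; exact: measurableT_comp.
  rewrite M0E//.
  have le k (l : 'I_(a k)) :
      \int[m (Tagged (fun k => 'I_(a k)) l)]_x `|f x|%:E <= (C * B)%:E * moment N l.
    rewrite mE//=.
    rewrite (_ : integral _ _ _ = \int[tau l]_r \int[S]_x
        `|f (scale_tuple r x) * peval (u l) x|%:E); last first.
      rewrite (fubini_tonelli1 (fun z => `|f (radial_product z)|%:E * (peval (u l) z.2)%:E)).
      - apply: eq_integral => r _; apply: eq_integral => x _.
        by rewrite -EFinM normrM (ger0_norm (u_ge0 _ x)).
      - apply: emeasurable_funM; last exact/measurable_EFinP.
        exact: (measurableT_comp mfa (@measurable_radial_product R d)).
      - by move=> z; rewrite mule_ge0 ?lee_fin.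
    apply: (le_trans (integral_radial_le d_gt0 (tau l) SE (u l) mf C0 fC)).
    rewrite muleC EFinM lee_wpmul2r ?moment_ge0// lee_wpmul2l ?lee_fin//.
    rewrite (integral_eq_measure _ SE); apply: le_trans (u_le l).
    by under eq_integral do rewrite ger0_norm//.
  apply: (@le_lt_trans _ _ (\sum_(0 <= k <oo) ((C * B)%:E * \sum_(l < a k) moment N l))).
    apply: lee_nneseries => [k _ _|k _].
      by apply: sume_ge0 => l _; apply: integral_ge0 => x _; rewrite lee_fin.
    by rewrite ge0_sume_distrr//; apply: lee_sum => l _; exact: le.
  rewrite nneseriesZl//; last by move=> k _; exact: sume_ge0.
  by rewrite lte_mul_pinfty ?lee_fin ?mulr_ge0// tau_sum.
have M0T : M0 setT < +oo.
  have g1 : poly_growth (cst 1%R : d.-tuple R -> R).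
    split => //; exists 1%R, 0%N; split => // x.
    by rewrite normr1 expr0 mul1r lerDl.
  apply: le_lt_trans (M0fin _ g1); rewrite (eq_integral (cst 1)) => [|x _].
    by rewrite integral_cst// mul1e.
  by rewrite /= normr1.
have [M ME] := exists_finite_measure M0T.
have Mint f : poly_growth f -> M.-integrable setT (EFin \o f).
  move=> gf; apply/integrableP; split; first by apply/measurable_EFinP; exact: gf.1.
  by rewrite (integral_eq_measure _ ME); exact: M0fin.
have pi_int f k (l : 'I_(a k)) : poly_growth f -> (tau l \x S).-integrable setT
    (fun z => (f (radial_product z) * peval (u l) z.2)%:E).
  by apply: integrable_radial => // N; exact: tau_moment_lty.
have ge0_cvg f : poly_growth f -> (forall x, (0 <= f x)%R) ->
    ((\sum_(0 <= k < n) \sum_(l < a k) part f l)%R @[n --> \oo] --> (\int[M]_x f x)%R).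
  move=> gf f0.
  have mf : measurable_fun setT (EFin \o f) by apply/measurable_EFinP; exact: gf.1.
  have partE k (l : 'I_(a k)) :
      (part f l)%:E = \int[m (Tagged (fun k => 'I_(a k)) l)]_x (f x)%:E.
    by rewrite /part /Rintegral fineK ?mE//; exact: integrable_fin_num (pi_int _ _ _ gf).
  have : \sum_(0 <= k < n) \sum_(l < a k) (part f l)%:E @[n --> \oo] --> \int[M]_x (f x)%:E.
    rewrite (integral_eq_measure _ ME) M0E//.
    under [X in _ --> X]eq_eseriesr do under eq_bigr do rewrite -partE.
    apply: is_cvg_nneseries => k _ _; apply: sume_ge0 => l _.
    by rewrite lee_fin; apply: Rintegral_ge0 => z _; rewrite mulr_ge0.
  rewrite -(fineK (integrable_fin_num measurableT (Mint _ gf))) => /fine_cvg.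
  rewrite -[X in _ --> X -> _]/(\int[M]_x f x)%R.
  apply: cvg_trans; apply: near_eq_cvg; near=> n => /=.
  by under eq_bigr do rewrite sumEFin; rewrite sumEFin.
exists M => f gf; split; first exact: Mint.
have gfp : poly_growth (fun x => Num.max (f x) 0%R).
  apply: (poly_growth_le _ _ gf) => [|x]; first exact: measurable_maxr gf.1 _.
  by case: (leP (f x) 0%R) => _; rewrite ?normr0.
have gfn : poly_growth (fun x => Num.max (- f x)%R 0%R).
  apply: (poly_growth_le _ _ gf) => [|x].
    by apply: measurable_maxr => //; apply: measurableT_comp => //; exact: gf.1.
  by case: (leP (- f x)%R 0%R) => _; rewrite ?normr0 ?normrN.
have fE x : f x = (Num.max (f x) 0 - Num.max (- f x) 0)%R.
  by case: (leP (f x) 0%R) => f0; case: (leP (- f x)%R 0%R) => f1; lra.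
rewrite (_ : \int[M]_x f x = \int[M]_x Num.max (f x) 0 -
  \int[M]_x Num.max (- f x) 0)%R; last first.
  by rewrite -RintegralB//; [apply: eq_Rintegral => x _; exact: fE|exact: Mint..].
rewrite (_ : (fun n => _) = (fun n =>
  \sum_(0 <= k < n) \sum_(l < a k) part (fun x => Num.max (f x) 0) l -
  \sum_(0 <= k < n) \sum_(l < a k) part (fun x => Num.max (- f x) 0) l)%R).
  by apply: cvgB; apply: ge0_cvg => // x; rewrite le_max lexx orbT.
apply/funext => n; rewrite -sumrB; apply: eq_bigr => k _; rewrite -sumrB; apply: eq_bigr => l _.
rewrite /part -RintegralB//; [|exact: (pi_int _ k l gfp)|exact: (pi_int _ k l gfn)].
by apply: eq_Rintegral => z _; rewrite -mulrBl -fE.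
Unshelve. all: by end_near. Qed.

End weighted_sum.

(** * The radial measures r^{-k} dsigma(r) *)

Section radial_measures.
Context {R : realType}.
Variable sigma : {measure set R -> \bar R}.
Local Notation halfline := (`[0%R, +oo[%classic : set R).

Lemma measurable_exprVn k : measurable_fun halfline (fun r : R => r ^- k)%R.
Proof.
apply: (@eq_measurable_fun _ _ _ _ _ (fun r : R => (r ^+ k) `^ (-1))%R).
  move=> r; rewrite inE/= in_itv/= andbT => r0.
  by rewrite powR_inv1// exprn_ge0.
apply: measurable_funTS; apply: (measurableT_comp (measurable_powR _)).
exact: exprn_measurable.
Qed.

(** Field inversion gives [r ^- k] the value 0 at r = 0 when k > 0, whereas [inv_power] is +oo
    there; the second summand is this discrepancy. *)
Lemma inv_powerE k (r : R) : inv_power k r =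
  (r ^- k)%:E + (if (0 < k)%N then +oo else 0) * (\1_[set 0%R] r)%:E.
Proof.
rewrite /inv_power indicE; case: k => [|k] /=; first by rewrite andbF mul0e adde0.
rewrite andbT; have [->|r0] := eqVneq r 0%R.
  by rewrite mem_set// mule1 addey.
by rewrite memNset ?mule0 ?adde0// => /eqP; rewrite (negbTE r0).
Qed.

Lemma measurable_inv_power k : measurable_fun halfline (@inv_power R k).
Proof.
rewrite (funext (inv_powerE k)); apply: emeasurable_funD.
  by apply/measurable_EFinP; exact: measurable_exprVn.
apply: emeasurable_funM => //; apply/measurable_EFinP; apply: measurable_funTS.
exact: measurable_indic.
Qed.

Let moment N k := \int[sigma]_(r in halfline) ((r ^+ N)%:E * inv_power k r).

Lemma integral_expr_le N k :
  \int[sigma]_(r in halfline) (r ^+ N * r ^- k)%:E <= moment N k.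
Proof.
apply: ge0_le_integral => //.
- by move=> r; rewrite /= in_itv/= andbT => r0; rewrite lee_fin mulr_ge0 ?invr_ge0 ?exprn_ge0.
- apply/measurable_EFinP/measurable_funM; last exact: measurable_exprVn.
  by apply: measurable_funTS; exact: exprn_measurable.
- apply: emeasurable_funM; last exact: measurable_inv_power.
  by apply/measurable_EFinP/measurable_funTS; exact: exprn_measurable.
- move=> r; rewrite /= in_itv/= andbT => r0; rewrite inv_powerE EFinM.
  apply: lee_wpmul2l; first by rewrite lee_fin exprn_ge0.
  by rewrite leeDl// mule_ge0 ?lee_fin//; case: ifP.
Qed.

(** The integrand is +oo at 0, so a positive mass there would make the moment infinite. *)
Lemma sigma_set10 k : (0 < k)%N -> moment 0 k < +oo -> sigma [set 0%R] = 0.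
Proof.
move=> k0 moo.
have h : \int[sigma]_(r in [set 0%R]) (cst +oo r) <= moment 0 k.
  rewrite (eq_integral (fun r : R => (r ^+ 0)%:E * inv_power k r)); last first.
    by move=> r; rewrite inE => ->; rewrite expr0 mul1e /inv_power eqxx k0.
  apply: ge0_subset_integral => //.
  - apply: emeasurable_funM; last exact: measurable_inv_power.
    by apply/measurable_EFinP/measurable_funTS; exact: exprn_measurable.
  - move=> r; rewrite /= in_itv/= andbT => r0; rewrite mule_ge0 ?lee_fin ?exprn_ge0//.
    by rewrite /inv_power; case: ifP => // _; rewrite lee_fin invr_ge0 exprn_ge0.
  - by move=> r ->; rewrite /= in_itv/= lexx.
move: (le_lt_trans h moo); rewrite integral_cst//.
have := measure_ge0 sigma [set 0%R]; rewrite le_eqVlt => /predU1P[<-//|s0].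
by rewrite gt0_mulye// ltxx.
Qed.

(** For k > 0 the density [r ^- k] has the value 0 at the origin; nothing is lost there, by
    [sigma_set10]. *)
Lemma exists_radial_measure k : moment 0 k < +oo ->
  exists tau : {finite_measure set R -> \bar R},
  forall h : R -> \bar R, measurable_fun setT h -> (forall r, 0 <= h r) ->
    \int[tau]_r h r = \int[sigma]_(r in halfline) (h r * (r ^- k)%:E).
Proof.
move=> moo; apply: exists_finite_density => //.
- exact: measurable_exprVn.
- by move=> r; rewrite /= in_itv/= andbT => r0; rewrite invr_ge0 exprn_ge0.
- apply: le_lt_trans moo; apply: le_trans (integral_expr_le 0 k).
  by under eq_integral do rewrite -[X in X%:E]mul1r.
Qed.

Lemma radial_moment_le (tau : {finite_measure set R -> \bar R}) N k :
  (forall h : R -> \bar R, measurable_fun setT h -> (forall r, 0 <= h r) ->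
    \int[tau]_r h r = \int[sigma]_(r in halfline) (h r * (r ^- k)%:E)) ->
  \int[tau]_r (1 + `|r| ^+ N)%:E <= moment 0 k + moment N k.
Proof.
move=> tauE; rewrite tauE; last 2 first.
- apply/measurable_EFinP/measurable_funD => //.
  by apply: measurable_funX; exact: normr_measurable.
- by move=> r; rewrite lee_fin addr_ge0// exprn_ge0.
apply: le_trans (leeD (integral_expr_le 0 k) (integral_expr_le N k)).
have mk j : measurable_fun halfline (fun r : R => (r ^+ j * r ^- k)%:E).
  apply/measurable_EFinP/measurable_funM; last exact: measurable_exprVn.
  by apply: measurable_funTS; exact: exprn_measurable.
have ge0 j (r : R) : halfline r -> 0 <= (r ^+ j * r ^- k)%:E.
  by rewrite /= in_itv/= andbT => r0; rewrite lee_fin mulr_ge0 ?invr_ge0 ?exprn_ge0.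
rewrite -ge0_integralD//; [|exact: ge0..].
apply: ge0_le_integral => //.
- move=> r; rewrite /= in_itv/= andbT => r0.
  by rewrite -EFinM lee_fin mulr_ge0 ?invr_ge0 ?addr_ge0 ?exprn_ge0.
- apply: emeasurable_funM; last by apply/measurable_EFinP; exact: measurable_exprVn.
  apply/measurable_EFinP/measurable_funD => //.
  by apply: measurable_funX; apply: measurable_funTS; exact: normr_measurable.
- exact: emeasurable_funD.
- move=> r; rewrite /= in_itv/= andbT => r0.
  by rewrite -EFinM -EFinD lee_fin expr0 ger0_norm// mulrDl.
Qed.

End radial_measures.

(** * Laplace-Fourier coefficients of polynomials and their value at 0 *)

Section laplace_fourier_theory.
Context {R : realType} {d : nat} (d_gt0 : (0 < d)%N).
Local Open Scope ring_scope.
Local Open Scope complex_scope.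
Implicit Types (P Q : {mpoly R[d]}) (f : {mpoly (R[i])[d]}) (x : d.-tuple R).

Let ReD (z w : R[i]) : complex.Re (z + w) = complex.Re z + complex.Re w.
Proof. by case: z; case: w. Qed.

Let ImD (z w : R[i]) : complex.Im (z + w) = complex.Im z + complex.Im w.
Proof. by case: z; case: w. Qed.

Lemma Re_mulrC (z : R[i]) (r : R) : complex.Re (z * r%:C) = complex.Re z * r.
Proof. by case: z => u v /=; rewrite mulr0 subr0. Qed.

Lemma Im_mulrC (z : R[i]) (r : R) : complex.Im (z * r%:C) = complex.Im z * r.
Proof. by case: z => u v /=; rewrite mulr0 add0r. Qed.

Lemma cpevalE f x : cpeval f x =
  \sum_(m <- msupp f) mcoeff m f * (peval (mpolyX R m) x)%:C.
Proof.
rewrite /cpeval mevalE; apply: eq_bigr => m _; rewrite peval_monomial rmorph_prod.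
by congr (_ * _); apply: eq_bigr => i _; rewrite rmorphXn.
Qed.

(** At real points this is the real part of f, so complex integrals split into integrals of real
    polynomials. *)
Definition Re_mpoly f : {mpoly R[d]} :=
  \sum_(m <- msupp f) complex.Re (mcoeff m f) *: mpolyX R m.

Definition Im_mpoly f : {mpoly R[d]} :=
  \sum_(m <- msupp f) complex.Im (mcoeff m f) *: mpolyX R m.

Lemma Re_cpeval f x : complex.Re (cpeval f x) = peval (Re_mpoly f) x.
Proof.
rewrite cpevalE (big_morph _ ReD (erefl : complex.Re 0 = 0)) /peval raddf_sum.
by apply: eq_bigr => m _; rewrite Re_mulrC /= mevalZ.
Qed.

Lemma Im_cpeval f x : complex.Im (cpeval f x) = peval (Im_mpoly f) x.
Proof.
rewrite cpevalE (big_morph _ ImD (erefl : complex.Im 0 = 0)) /peval raddf_sum.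
by apply: eq_bigr => m _; rewrite Im_mulrC /= mevalZ.
Qed.

Lemma laplace_fourierE P f r : laplace_fourier P f r =
  sphere_coeff P (peval (Re_mpoly f)) r +i* sphere_coeff P (peval (Im_mpoly f)) r.
Proof.
rewrite /laplace_fourier /cintegral; congr (_ +i* _); apply: eq_Rintegral => x _ /=.
  by rewrite Re_mulrC Re_cpeval.
by rewrite Im_mulrC Im_cpeval.
Qed.

(** P is a constant, so a monomial of degree n contributes a multiple of s^n, the factor being c
    times its integral over the sphere; for odd n this integral is 0. *)
Lemma sphere_coeff_even P Q : P \is ishomog1 0 mdeg ->
  exists q : {poly R}, forall s, sphere_coeff P (peval Q) s = q.[s ^+ 2].
Proof.
move=> P0; have [c cE] : exists c, forall x, peval P x = c.
  exists (peval P [tuple 0 | i < d]) => x.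
  rewrite /peval !mevalE !big_seq; apply: eq_bigr => m mP; congr (_ * _).
  apply: eq_bigr => i _; suff -> : m i = 0%N by rewrite !expr0.
  have := ishomog1E P0 mP; rewrite mdegE => /eqP; rewrite sum_nat_eq0 => /forallP/(_ i).
  by move/eqP.
have int Q' s := integrable_sphere_scale d_gt0 P s (poly_growth_peval Q').
elim/mpolyind : Q => [|b m Q _ _ [q qE]].
  exists 0 => s; rewrite horner0 -(mul0r (fine (sphere_measure d setT))).
  rewrite -Rintegral_cst//; apply: eq_Rintegral => x _.
  by rewrite /peval meval0 mul0r.
pose I : R := \int[sphere_measure d]_x peval (mpolyX R m) x.
exists ((b * c * I) *: 'X^((mdeg m)./2) + q) => s.
rewrite hornerD hornerZ hornerXn -qE /sphere_coeff.
transitivity (\int[sphere_measure d]_x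
    (b * (peval (mpolyX R m) (scale_tuple s x) * peval P x) +
     peval Q (scale_tuple s x) * peval P x)).
  by apply: eq_Rintegral => x _; rewrite /peval mevalD mevalZ mulrDl mulrA.
rewrite RintegralD//; last exact: (integrableZl measurableT b (int (mpolyX R m) s)).
rewrite RintegralZl//; congr (_ + _); rewrite -!mulrA; congr (_ * _).
transitivity (\int[sphere_measure d]_x (c * s ^+ mdeg m * peval (mpolyX R m) x)).
  apply: eq_Rintegral => x _; rewrite cE (@peval_scale _ _ (mdeg m)) ?dhomogX//.
  by rewrite mulrC mulrA.
rewrite RintegralZl//; last exact: integrable_sphere_peval.
rewrite -/I -mulrA; congr (_ * _); rewrite mulrC.
have [om|em] := boolP (odd (mdeg m)).
  by rewrite /I sphere_integral_odd_monomial// !mul0r.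
by rewrite -exprM mul2n (halfK (mdeg m)) (negbTE em) subn0.
Qed.

Lemma poly_eq_sqr (p q : {poly R[i]}) :
  (forall s : R, 0 < s -> p.[(s ^+ 2)%:C] = q.[(s ^+ 2)%:C]) -> p = q.
Proof.
move=> pq; apply/eqP; rewrite -subr_eq0; apply/negPn/negP => pq0.
(* These are the points 1, 2, ..., as many distinct roots as [size (p - q)], which is one too many
   for a nonzero polynomial. *)
pose rs := [seq ((Num.sqrt n.+1%:R : R) ^+ 2)%:C | n <- iota 0 (size (p - q))].
have := max_poly_roots (rs := rs) pq0.
rewrite size_map size_iota ltnn => /(_ _ _)/negP; apply => //.
  by apply/allP => _ /mapP[n _ ->]; rewrite rootE hornerD hornerN pq ?subrr// sqrtr_gt0.
rewrite map_inj_uniq ?iota_uniq// => i j [] /eqP.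
by rewrite !sqr_sqrtr ?ler0n// eqr_nat eqSS => /eqP.
Qed.

(** The value at 0 comes from a polynomial chosen by [xget]. Such a polynomial exists by
    [sphere_coeff_even] and is unique by [poly_eq_sqr], so the choice is the one that also gives the
    coefficient at s = 0. *)
Lemma laplace_fourier_quotient00 P f : P \is ishomog1 0 mdeg ->
  laplace_fourier_quotient 0 P f 0 = laplace_fourier P f 0.
Proof.
move=> P0; have [q1 q1E] := sphere_coeff_even (Re_mpoly f) P0.
have [q2 q2E] := sphere_coeff_even (Im_mpoly f) P0.
pose q : {poly R[i]} := map_poly (real_complex R) q1 + 'i *: map_poly (real_complex R) q2.
have qE (s : R) : laplace_fourier P f s = q.[(s ^+ 2)%:C].
  rewrite laplace_fourierE q1E q2E hornerD hornerZ !horner_map/=.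
  by apply/eqP; rewrite eq_complex/= !(mul0r, mulr0, mul1r, addr0, add0r, subr0) !eqxx.
rewrite /laplace_fourier_quotient eqxx; case: xgetP => [p _ pE|/(_ q)[]]; last first.
  by move=> s s0; rewrite expr0 invr1 mulr1 qE.
have -> : p = q.
  by apply: poly_eq_sqr => s s0; rewrite -pE// expr0 invr1 mulr1 qE.
by rewrite qE expr0n.
Qed.

End laplace_fourier_theory.

(* sigma can charge the origin only if k = 0, so that the value of the quotient
   at 0 only matters in this case. *)
Lemma cintegral_laplace_fourier_quotient {R : realType} {d : nat} (d_gt0 : (0 < d)%N)
    (sigma : {measure set R -> \bar R}) k (P : {mpoly R[d]}) (f : {mpoly (R[i])[d]}) :
  P \is ishomog1 k mdeg -> ((0 < k)%N -> sigma [set 0%R] = 0) ->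
  (forall g, poly_growth g -> measurable_fun setT (sphere_coeff P g)) ->
  cintegrable sigma `[0%R, +oo[%classic (laplace_fourier_quotient k P f) ->
  cintegral sigma `[0%R, +oo[%classic (laplace_fourier_quotient k P f) =
  ((\int[sigma]_(r in `[0, +oo[) (sphere_coeff P (peval (Re_mpoly f)) r * r ^- k)) +i*
   (\int[sigma]_(r in `[0, +oo[) (sphere_coeff P (peval (Im_mpoly f)) r * r ^- k)))%C%R.
Proof.
move=> Pk s0 mP [iRe iIm].
have qE (r : R) : (r != 0)%R \/ k = 0%N -> laplace_fourier_quotient k P f r =
    ((sphere_coeff P (peval (Re_mpoly f)) r * r ^- k) +i*
     (sphere_coeff P (peval (Im_mpoly f)) r * r ^- k))%C%R.
  have [-> [//|k0]|r0 _] := eqVneq r 0%R.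
    have P0 : P \is ishomog1 0 mdeg by move: Pk; rewrite k0.
    by rewrite k0 (laplace_fourier_quotient00 d_gt0 f P0) laplace_fourierE expr0 invr1 !mulr1.
  rewrite /laplace_fourier_quotient (negbTE r0) laplace_fourierE.
  rewrite -rmorphXn -fmorphV.
  by apply/eqP; rewrite eq_complex/= !(mul0r, mulr0, addr0, add0r, subr0) !eqxx.
have mg (g : d.-tuple R -> R) : poly_growth g ->
    measurable_fun (`[0%R, +oo[%classic : set R) (fun r : R => sphere_coeff P g r * r ^- k)%R.
  move=> gg; apply: measurable_funM; last exact: measurable_exprVn.
  by apply: measurable_funTS; exact: mP.
have ae (h1 h2 : R -> R) : (forall r, (r != 0)%R \/ k = 0%N -> h1 r = h2 r) ->
    sigma.-integrable (`[0%R, +oo[%classic : set R) (EFin \o h1) ->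
    measurable_fun (`[0%R, +oo[%classic : set R) h2 ->
    (\int[sigma]_(r in `[0, +oo[) h1 r = \int[sigma]_(r in `[0, +oo[) h2 r)%R.
  move=> h12 i1 m2; rewrite /Rintegral; congr fine; apply: ae_eq_integral => //.
  - exact: measurable_int i1.
  - exact/measurable_EFinP.
  have [k0|k0] := posnP k; first by apply: aeW => r _; rewrite /= h12//; right.
  exists [set 0%R]; split => //; first exact: s0.
  move=> r /= h; apply: contrapT => /eqP r0; apply: h => _.
  by rewrite h12//; left.
rewrite /cintegral; congr (_ +i* _)%C; apply: ae => //.
- by move=> r rk; rewrite /= qE.
- by apply: mg; exact: poly_growth_peval.
- by move=> r rk; rewrite /= qE.
- by apply: mg; exact: poly_growth_peval.
Qed.

Section mdegree_theory.
Context {R : realType} {d : nat}.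
Implicit Types f g : {mpoly (R[i])[d]}.

Lemma mdegree_monomial (m : multinom d) : mdegree (mpolyX R[i] m) = mdeg m.
Proof. by rewrite /mdegree mmeasureX. Qed.

Lemma mdegreeD f (m : multinom d) : (mdegree f < mdeg m)%N ->
  mdegree (f + mpolyX R[i] m)%R = mdeg m.
Proof.
move=> fm; have fm' : (mmeasure mdeg f <= mdeg m)%N.
  by move: fm; rewrite /mdegree; case: mmeasure.
suff -> : mdegree (f + mpolyX R[i] m)%R = (mdeg m).+1.-1 by [].
congr _.-1; apply/eqP; rewrite eqn_leq; apply/andP; split.
  by apply: leq_trans (mmeasureD_le _ _ _) _; rewrite geq_max mmeasureX leqnn andbT leqW.
apply: mmeasure_mnm_lt; rewrite mcoeff_msupp mcoeffD mcoeffX eqxx memN_msupp_eq0.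
  by rewrite add0r oner_neq0.
exact: (mmeasure_mnm_ge fm').
Qed.

End mdegree_theory.

(** * Construction of the signed measure *)

Section radial_charge.
Context {R : realType} {d : nat} (d_gt0 : (0 < d)%N).

Lemma measurable_sphere_coeff_growth (f : d.-tuple R -> R) P :
  poly_growth f -> measurable_fun setT (sphere_coeff P f).
Proof.
have [S SE] := exists_finite_measure (@sphere_setT_lty R d).
(* The coefficient does not involve the radial measure, so its measurability is read off from
   Fubini's theorem for a Dirac mass, whose moments are finite. *)
suff m0 N : \int[dirac (0%R : R)]_r (1 + `|r| ^+ N)%:E < +oo.
  exact: (measurable_sphere_coeff (tau := dirac (0%R : R)) d_gt0 SE m0 P).
rewrite integral_dirac//; last by apply/measurable_EFinP/measurable_funD => //;
  apply: measurable_funX; exact: normr_measurable.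
by rewrite diracT mul1e ltry.
Qed.

(* P = half_sqr P - half_sqr (- P) is a difference of nonnegative polynomials. *)
Definition half_sqr (P : {mpoly R[d]}) : {mpoly R[d]} := ((2^-1 *: (1 + P)) ^+ 2)%R.

Lemma peval_half_sqr P x : peval (half_sqr P) x = ((1 + peval P x) / 2 * ((1 + peval P x) / 2))%R.
Proof. by rewrite /peval /half_sqr rmorphXn /= mevalZ mevalD meval1 expr2 [(2^-1 * _)%R]mulrC. Qed.

(** Pointwise ((1 + p)/2)^2 <= 1 + p^2, so the normalisation alone bounds the integral,
    independently of the degree. *)
Lemma sphere_integral_half_sqr P :
  (\int[sphere_measure d]_x (peval P x * peval P x) = 1)%R ->
  \int[sphere_measure d]_x (peval (half_sqr P) x)%:E <= sphere_measure d [set: d.-tuple R] + 1.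
Proof.
move=> P1.
have mP := measurable_peval P.
have <- : \int[sphere_measure d]_x (peval P x * peval P x)%:E = 1.
  rewrite -[RHS](congr1 EFin P1) /Rintegral fineK//.
  have := integrable_sphere_peval d_gt0 (P * P)%R => /(integrable_fin_num measurableT).
  by congr (_ \is a fin_num); apply: eq_integral => x _; rewrite /= /peval mevalM.
rewrite -[X in X + _]mul1e -integral_cst// -ge0_integralD//; last 2 first.
- by move=> x _; rewrite lee_fin -expr2 sqr_ge0.
- by apply/measurable_EFinP; exact: measurable_funM.
apply: ge0_le_integral => //.
- by move=> x _; rewrite peval_half_sqr lee_fin -expr2 sqr_ge0.
- by apply/measurable_EFinP; exact: measurable_peval.
- by apply: emeasurable_funD => //; apply/measurable_EFinP; exact: measurable_funM.
- by move=> x _; rewrite peval_half_sqr -EFinD lee_fin; nra.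
Qed.

Section inverse_power_moments.
Variables (a : nat -> nat) (sigma : forall k, 'I_(a k) -> {measure set R -> \bar R}).
Hypothesis moment_sum : forall N : nat, \sum_(0 <= k <oo) \sum_(l < a k)
  \int[sigma l]_(r in `[0%R, +oo[%classic) ((r ^+ N)%:E * inv_power k r) < +oo.

Let moment N k (l : 'I_(a k)) :=
  \int[sigma l]_(r in `[0%R, +oo[%classic) ((r ^+ N)%:E * inv_power k r).

Lemma inv_power_moment_ge0 N k (l : 'I_(a k)) : 0 <= moment N l.
Proof.
apply: integral_ge0 => r; rewrite /= in_itv/= andbT => r0.
rewrite mule_ge0 ?lee_fin ?exprn_ge0// /inv_power; case: ifP => // _.
by rewrite lee_fin invr_ge0 exprn_ge0.
Qed.

Lemma inv_power_moment_lty N k (l : 'I_(a k)) : moment N l < +oo.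
Proof.
apply: le_lt_trans (moment_sum N).
apply: (@le_trans _ _ (\sum_(i < a k) moment N i)).
  by rewrite (bigD1 l)//= leeDl// ?sume_ge0// => *; exact: inv_power_moment_ge0.
apply: (@le_term_nneseries _ (fun k => \sum_(i < a k) moment N i)) => n.
by apply: sume_ge0 => *; exact: inv_power_moment_ge0.
Qed.

(** Linearity is obtained on the product with the sphere, where growth and finite moments give
    integrability. *)
Lemma Rintegral_sphere_coeffB k (l : 'I_(a k)) P (f g h : d.-tuple R -> R) :
  poly_growth f -> poly_growth g -> poly_growth h -> (forall x, h x = f x - g x)%R ->
  (\int[sigma l]_(r in `[0, +oo[) (sphere_coeff P h r * r ^- k) =
   \int[sigma l]_(r in `[0, +oo[) (sphere_coeff P f r * r ^- k) -
   \int[sigma l]_(r in `[0, +oo[) (sphere_coeff P g r * r ^- k))%R.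
Proof.
move=> gf gg gh hE.
have [S SE] := exists_finite_measure (@sphere_setT_lty R d).
have [tau tauE] := exists_radial_measure (inv_power_moment_lty 0 l).
have tau_moment N : \int[tau]_r (1 + `|r| ^+ N)%:E < +oo.
  apply: (le_lt_trans (radial_moment_le N tauE)).
  exact: lte_add_pinfty (inv_power_moment_lty 0 l) (inv_power_moment_lty N l).

rewrite -!(Rintegral_radial_density d_gt0 SE tau_moment P tauE)//.
rewrite -RintegralB//; [|exact: (integrable_radial d_gt0 SE tau_moment)..].
by apply: eq_Rintegral => z _; rewrite hE mulrBl.
Qed.

End inverse_power_moments.

(** The charge is the difference of the measures with weights [half_sqr Y] and [half_sqr (- Y)]. The
    limit is expressed through integrals against [sigma k l], the form in which the representation
    of T and orthogonality can be applied. *)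
Lemma exists_radial_charge (a : nat -> nat) (Y : forall k, 'I_(a k) -> {mpoly R[d]})
    (sigma : forall k, 'I_(a k) -> {measure set R -> \bar R}) :
  (forall k (l : 'I_(a k)),
    (\int[sphere_measure d]_x (peval (Y k l) x * peval (Y k l) x) = 1)%R) ->
  (forall N : nat, \sum_(0 <= k <oo) \sum_(l < a k)
      \int[sigma k l]_(r in `[0%R, +oo[%classic) ((r ^+ N)%:E * inv_power k r) < +oo) ->
  exists nu : {charge set (d.-tuple R) -> \bar R},
  forall f : d.-tuple R -> R, poly_growth f ->
    (Defs.total_variation nu).-integrable setT (EFin \o f) /\
    ((\sum_(0 <= k < n) \sum_(l < a k) \int[sigma k l]_(r in `[0, +oo[)
        (sphere_coeff (Y k l) f r * r ^- k))%R @[n --> \oo] --> charge_integral nu f).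
Proof.
move=> Y1 hsum.
have [S SE] := exists_finite_measure (@sphere_setT_lty R d).

have /choice[t tE] : forall kl : {k & 'I_(a k)}, exists tau : {finite_measure set R -> \bar R},
    forall h : R -> \bar R, measurable_fun setT h -> (forall r, 0 <= h r) ->
    \int[tau]_r h r = \int[sigma _ (tagged kl)]_(r in `[0%R, +oo[%classic) (h r * (r ^- tag kl)%:E).
  by case=> k l; exact: exists_radial_measure (inv_power_moment_lty hsum 0 l).
pose tau k (l : 'I_(a k)) := t (Tagged (fun k => 'I_(a k)) l).
have tauE k l := tE (Tagged (fun k => 'I_(a k)) (l : 'I_(a k))).
have tau_sum N : \sum_(0 <= k <oo) \sum_(l < a k) \int[tau k l]_r (1 + `|r| ^+ N)%:E < +oo.
  have := lte_add_pinfty (hsum 0%N) (hsum N); rewrite -nneseriesD; last 2 first.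
  - by move=> k _ _; apply: sume_ge0 => l _; exact: inv_power_moment_ge0.
  - by move=> k _ _; apply: sume_ge0 => l _; exact: inv_power_moment_ge0.
  apply: le_lt_trans; apply: lee_nneseries => k _.
    by move=> _; apply: sume_ge0 => l _; apply: integral_ge0 => r _;
      rewrite lee_fin addr_ge0// exprn_ge0.
  rewrite -big_split/=; apply: lee_sum => l _.
  by apply: radial_moment_le; exact: tauE.
have tau_moment k (l : 'I_(a k)) N := tau_moment_lty tau_sum l N.
pose B : R := (fine (sphere_measure d [set: d.-tuple R]) + 1)%R.
have B0 : (0 <= B)%R by rewrite addr_ge0// fine_ge0.
have BE : B%:E = sphere_measure d [set: d.-tuple R] + 1.
  by rewrite EFinD fineK// ge0_fin_numE//; exact: sphere_setT_lty.
have half_ge0 P x : (0 <= peval (half_sqr P) x)%R.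
  by rewrite peval_half_sqr -expr2 sqr_ge0.
have [M1 M1E] := @exists_weighted_sum _ _ d_gt0 a S SE tau tau_sum
  (fun k l => half_sqr (Y k l)) (fun k l => half_ge0 (Y k l)) B B0
  (fun k l => eq_ind_r (fun b => _ <= b) (sphere_integral_half_sqr (Y1 k l)) BE).
(* [- Y] has the same L^2 norm as [Y], so the constant [B] also serves for the second measure. *)
have N1 k l : (\int[sphere_measure d]_x (peval (- Y k l) x * peval (- Y k l) x) = 1)%R.
  by rewrite -(Y1 k l); apply: eq_Rintegral => x _; rewrite /peval mevalN mulrNN.
have [M2 M2E] := @exists_weighted_sum _ _ d_gt0 a S SE tau tau_sum
  (fun k l => half_sqr (- Y k l)%R) (fun k l => half_ge0 (- Y k l)%R) B B0
  (fun k l => eq_ind_r (fun b => _ <= b) (sphere_integral_half_sqr (N1 k l)) BE).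
have [nu nuE] := exists_chargeB M1 M2.
exists nu => f gf; have [i1 c1] := M1E f gf; have [i2 c2] := M2E f gf.
split; first exact (integrable_total_variation nuE i1 i2).
rewrite (charge_integralE nuE i1 i2).
rewrite (_ : (fun n => _) = (fun n =>
  \sum_(0 <= k < n) \sum_(l < a k) \int[tau k l \x S]_z
    (f (radial_product z) * peval (half_sqr (Y k l)) z.2) -
  \sum_(0 <= k < n) \sum_(l < a k) \int[tau k l \x S]_z
    (f (radial_product z) * peval (half_sqr (- Y k l)%R) z.2))%R).
  exact: cvgB c1 c2.
apply/funext => n; rewrite -sumrB; apply: eq_bigr => k _; rewrite -sumrB; apply: eq_bigr => l _.
rewrite -(Rintegral_radial_density d_gt0 SE (tau_moment k l) (Y k l) (tauE k l) gf).
rewrite -RintegralB//; [|exact: (integrable_radial d_gt0 SE (tau_moment k l))..].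
apply: eq_Rintegral => z _; rewrite -mulrBr !peval_half_sqr /peval mevalN.
by congr (_ * _)%R; field.
Qed.

End radial_charge.

(** * Radial test functions *)

Section radial_functions.
Context {R : realType} {d : nat} (d_gt0 : (0 < d)%N).
Local Open Scope ring_scope.

(** On |theta| = 1 one has h(|r theta|) P(r theta) = h(|r|) r^k P(theta): the radial factor leaves
    the integral, and only the inner product of P and Q remains. *)
Lemma sphere_coeff_radial k (P Q : {mpoly R[d]}) (h : R -> R) r :
  P \is ishomog1 k mdeg -> measurable_fun setT (fun x : d.-tuple R => h (enorm x)) ->
  sphere_coeff Q (fun x => h (enorm x) * peval P x) r =
  h `|r| * r ^+ k * \int[sphere_measure d]_x (peval P x * peval Q x).
Proof.
move=> Pk mh; rewrite -RintegralZl//; last first.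
  have := integrable_sphere_peval d_gt0 (P * Q).
  by apply: eq_integrable => // x _; rewrite /= /peval mevalM.
rewrite /sphere_coeff /Rintegral; congr fine; apply: ae_eq_integral => //.
- apply/measurable_EFinP/measurable_funM; last exact: measurable_peval.
  have mhP : measurable_fun setT (fun x : d.-tuple R => h (enorm x) * peval P x).
    by apply: measurable_funM => //; exact: measurable_peval.
  exact: (measurableT_comp mhP (measurable_scale_tuple r)).
- apply/measurable_EFinP; apply: measurable_funM => //.
  by apply: measurable_funM; exact: measurable_peval.
- apply: filterS (sphere_ae_norm1 d_gt0) => x x1 _ /=.
  by rewrite enorm_scale_norm x1 mulr1 (peval_scale _ _ Pk) !mulrA.
Qed.

Lemma compact_support_bounded (h : R -> R) :
  {within `[0, +oo[, continuous h} -> compact (closure [set r | 0 <= r /\ h r != 0]) ->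
  exists2 C, 0 <= C & forall r, 0 <= r -> `|h r| <= C.
Proof.
move=> ch ck.
have sub : closure [set r | 0 <= r /\ h r != 0] `<=` (`[0, +oo[ : set R).
  rewrite [X in _ `<=` X](closure_id _).1; last exact: rray_closed.
  by apply: closureS => r [r0 _]; rewrite /= in_itv/= r0.
have [M [_ hM]] := compact_bounded (continuous_compact (continuous_subspaceW sub ch) ck).
(* [compact_bounded] gives the bound for each constant greater than [M]; this one is also
   nonnegative, which covers the points where h vanishes. *)
exists (`|M| + 1); first by rewrite addr_ge0.
move=> r r0; have [->|hr] := eqVneq (h r) 0; first by rewrite normr0 addr_ge0.
apply: (hM (`|M| + 1)); first by rewrite ltr_pwDr// ler_norm.
by exists r => //; exact: subset_closure.
Qed.

Lemma measurable_comp_enorm (h : R -> R) :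
  {within `[0, +oo[, continuous h} -> measurable_fun setT (fun x : d.-tuple R => h (enorm x)).
Proof.
move=> ch; have mh : measurable_fun (`[0, +oo[ : set R) h.
  by apply: subspace_continuous_measurable_fun.
apply: (measurable_comp _ _ mh) => //; last exact: measurable_enorm.
by move=> _ [x _ <-]; rewrite /= in_itv/= andbT enorm_ge0.
Qed.

Lemma poly_growth_radial (h : R -> R) (P : {mpoly R[d]}) :
  {within `[0, +oo[, continuous h} -> compact (closure [set r | 0 <= r /\ h r != 0]) ->
  poly_growth (fun x => h (enorm x) * peval P x).
Proof.
move=> ch ck; have [C C0 hC] := compact_support_bounded ch ck.
have mP := measurable_peval P.
apply: (@poly_growth_le _ _ (peval (C *: P))).
- by apply: measurable_funM => //; exact: measurable_comp_enorm.
- move=> x; rewrite /peval mevalZ !normrM ler_wpM2r// (ger0_norm C0).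
  by rewrite hC// enorm_ge0.
- exact: poly_growth_peval.
Qed.

End radial_functions.

(** * Signs of the terms, and T as an eventually constant partial sum *)

Section representation.
Context {R : realType} {d : nat} (d_gt0 : (0 < d)%N) (a : nat -> nat).
Variable Y : forall k, 'I_(a k) -> {mpoly R[d]}.
Hypothesis Y_basis : forall k, orthonormal_harmonic_basis k (@Y k).
Variable sigma : forall k, 'I_(a k) -> {measure set R -> \bar R}.
Hypothesis moment_sum : forall N : nat, \sum_(0 <= k <oo) \sum_(l < a k)
  \int[sigma l]_(r in `[0%R, +oo[%classic) ((r ^+ N)%:E * inv_power k r) < +oo.
Local Open Scope ring_scope.

Let part (f : d.-tuple R -> R) k (l : 'I_(a k)) : R :=
  \int[sigma l]_(r in `[0, +oo[) (sphere_coeff (Y l) f r * r ^- k).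

(** Each term is nonnegative by itself: terms with k' != k vanish by orthogonality between degrees,
    those with k' = k and l' != l by orthonormality, and the remaining one integrates h(r) r^k
    r^{-k} >= 0. *)
Lemma part_radial_ge0 (h : R -> R) k (l : 'I_(a k)) k' (l' : 'I_(a k')) :
  {within `[0, +oo[, continuous h} -> (forall r, 0 <= r -> 0 <= h r) ->
  0 <= part (fun x => h (enorm x) * peval (Y l) x) l'.
Proof.
move=> ch h0; apply: Rintegral_ge0 => r; rewrite /= in_itv/= andbT => r0.
have [/(_ l)[Yk Yl] _ Yon] := Y_basis k.
rewrite (sphere_coeff_radial d_gt0 _ _ Yk (measurable_comp_enorm ch)) ger0_norm//.
rewrite mulr_ge0 ?invr_ge0 ?exprn_ge0// mulr_ge0 ?mulr_ge0 ?h0 ?exprn_ge0//.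
have [kk'|kk'] := eqVneq k k'; last first.
  have [/(_ l')Y' _ _] := Y_basis k'.
  by rewrite (sphere_harmonic_orthogonal d_gt0 kk' (conj Yk Yl) Y').
by subst k'; rewrite Yon ler0n.
Qed.

Variable T : {scalar {mpoly (R[i])[d]}}.
Hypothesis T_rep : represents (@Y) (@sigma) T.

(** The quotients, with their chosen values at 0, are traded for the real integrals whose sums
    converge to integrals against the charge. *)
Lemma represents_mdegree (g : {mpoly (R[i])[d]}) :
  T g = ((\sum_(0 <= k < (mdegree g).+1) \sum_(l < a k) part (peval (Re_mpoly g)) l) +i*
         (\sum_(0 <= k < (mdegree g).+1) \sum_(l < a k) part (peval (Im_mpoly g)) l))%C.
Proof.
have [gint ->] := T_rep g.
transitivity (\sum_(0 <= k < (mdegree g).+1) \sum_(l < a k)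
  (part (peval (Re_mpoly g)) l +i* part (peval (Im_mpoly g)) l)%C).
  apply: eq_big_nat => k /= kg; apply: eq_bigr => l _.
  apply: cintegral_laplace_fourier_quotient => //.
  - by have [/(_ l)[]] := Y_basis k.
  - by move=> k0; exact: sigma_set10 k0 (inv_power_moment_lty moment_sum 0 l).
  - by move=> f; exact: measurable_sphere_coeff_growth.
  - by apply: gint; rewrite -ltnS.
have ReD : {morph @complex.Re R : x y / x + y >-> x + y} by case=> ? ? [].
have ImD : {morph @complex.Im R : x y / x + y >-> x + y} by case=> ? ? [].
apply/eqP; rewrite eq_complex /=; apply/andP; split; apply/eqP.
  rewrite (big_morph _ ReD (erefl : complex.Re 0 = 0)); apply: eq_bigr => k _.
  exact: (big_morph _ ReD (erefl : complex.Re 0 = 0)).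
rewrite (big_morph _ ImD (erefl : complex.Im 0 = 0)); apply: eq_bigr => k _.
exact: (big_morph _ ImD (erefl : complex.Im 0 = 0)).
Qed.

(* Adding a monomial of degree n to f makes the representation of T run up to
   degree n, and this monomial can be subtracted afterwards. *)
Lemma represents_partial_sum (f : {mpoly (R[i])[d]}) n : (mdegree f < n)%N ->
  T f = ((\sum_(0 <= k < n.+1) \sum_(l < a k) part (peval (Re_mpoly f)) l) +i*
         (\sum_(0 <= k < n.+1) \sum_(l < a k) part (peval (Im_mpoly f)) l))%C.
Proof.
move=> fn; pose m := mnm_muln (mnm1 (Ordinal d_gt0)) n.
have mn : mdeg m = n by rewrite mdegMn mdeg1 mul1n.
pose X : {mpoly (R[i])[d]} := mpolyX _ m.
have mX : mdegree X = n by rewrite mdegree_monomial.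
have mfX : mdegree (f + X) = n by rewrite mdegreeD mn.
pose F (p : {mpoly R[d]}) := \sum_(0 <= k < n.+1) \sum_(l < a k) part (peval p) l.
have TE g : mdegree g = n -> T g = (F (Re_mpoly g) +i* F (Im_mpoly g))%C.
  by move=> gn; rewrite represents_mdegree gn.
have FB p q r : (forall x, peval r x = peval p x - peval q x) -> F r = F p - F q.
  move=> rE; rewrite -sumrB; apply: eq_bigr => k _; rewrite -sumrB; apply: eq_bigr => l _.
  by apply: Rintegral_sphere_coeffB => //; exact: poly_growth_peval.
change (T f = (F (Re_mpoly f) +i* F (Im_mpoly f))%C).
rewrite (FB (Re_mpoly (f + X)) (Re_mpoly X) (Re_mpoly f)); last first.
  move=> x; rewrite -!Re_cpeval /cpeval mevalD.
  by case: (meval _ f) => ? ?; case: (meval _ X) => ? ? /=; rewrite addrK.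
rewrite (FB (Im_mpoly (f + X)) (Im_mpoly X) (Im_mpoly f)); last first.
  move=> x; rewrite -!Im_cpeval /cpeval mevalD.
  by case: (meval _ f) => ? ?; case: (meval _ X) => ? ? /=; rewrite addrK.
have -> : T f = T (f + X) - T X by rewrite linearD addrK.
by rewrite !TE.
Qed.

End representation.

Theorem corollary11 (R : realType) (d : nat) (hd : (2 <= d)%N)
  (a : nat -> nat) (Y : forall k, 'I_(a k) -> {mpoly R[d]})
  (hY : forall k, orthonormal_harmonic_basis k (Y k))
  (T : {scalar {mpoly (R[i])[d]}})
  (hT : pseudo_positive_definite Y T)
  (sigma : forall k, 'I_(a k) -> {measure set R -> \bar R})
  (hsupp : forall k (l : 'I_(a k)), sigma k l `]-oo, 0%R[%classic = 0)
  (hrep : represents Y sigma T)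
  (hsum : forall N : nat,
    \sum_(0 <= k <oo) \sum_(l < a k)
      \int[sigma k l]_(r in `[0%R, +oo[%classic) ((r ^+ N)%:E * inv_power k r) < +oo) :
  exists nu : {charge set (d.-tuple R) -> \bar R},
    [/\ pseudo_positive Y nu, moment_charge nu &
        forall f : {mpoly (R[i])[d]}, T f = charge_cintegral nu (cpeval f)].
Proof.
have d_gt0 := ltnW hd.
have Y_norm k l : (\int[sphere_measure d]_x (peval (Y k l) x * peval (Y k l) x) = 1)%R.
  by have [_ _ ->] := hY k; rewrite eqxx.
have [nu nuE] := exists_radial_charge d_gt0 Y_norm hsum.
have ReE (f : {mpoly (R[i])[d]}) : @complex.Re R \o cpeval f = peval (Re_mpoly f).
  by apply/funext => x; exact: Re_cpeval.
have ImE (f : {mpoly (R[i])[d]}) : @complex.Im R \o cpeval f = peval (Im_mpoly f).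
  by apply/funext => x; exact: Im_cpeval.
exists nu; split.
- move=> h ch h0 ck k l; have [_ cvg] := nuE _ (poly_growth_radial (Y k l) ch ck).
  rewrite -(cvg_lim (@norm_hausdorff _ _) cvg); apply: limr_ge.
    by apply/cvg_ex; eexists; exact: cvg.
  apply: nearW => n; apply: sumr_ge0 => k' _; apply: sumr_ge0 => l' _.
  exact: (part_radial_ge0 d_gt0 hY).
- move=> f; rewrite /cintegrable ReE ImE.
  by split; exact: (nuE _ (poly_growth_peval _)).1.
- move=> f; have Tn := represents_partial_sum d_gt0 hY hsum hrep (f := f).
  have lim_const (u : nat -> R) (c l : R) : u n @[n --> \oo] --> l ->
      (forall n, (mdegree f < n)%N -> u n.+1 = c) -> l = c.
    move=> ul uc; apply: (cvg_unique (@norm_hausdorff _ _) ul).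
    (* For n > deg f, [represents_partial_sum] concerns the sum over k < n + 1, so the sequence is
       constant from index deg f + 2 on. *)
    apply: cvg_near_cst; exists (mdegree f).+2 => // -[//|n] /= fn.
    by rewrite uc.
  have RT := lim_const _ (complex.Re (T f)) _ (nuE _ (poly_growth_peval (Re_mpoly f))).2.
  have IT := lim_const _ (complex.Im (T f)) _ (nuE _ (poly_growth_peval (Im_mpoly f))).2.
  rewrite /charge_cintegral /cintegral ReE ImE.
  transitivity ((charge_integral nu (peval (Re_mpoly f))) +i*
     (charge_integral nu (peval (Im_mpoly f))))%C => //.
  rewrite RT ?IT; [by case: (T f)|by move=> n /Tn ->..].
Qed.
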